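(* Let $a,b,n\geq 2$ be positive integers such that $\gcd(a,b)=1$. Suppose that there are prime numbers $s\mid a$ and $t\mid b$ such that $\gcd(st,n)=1$ (in particular, this holds if $\gcd(ab,n)=1$). Then there is a finite group $H$ such that \[ |\mathrm{Hom}(G_n(GK_{a,b}),H)| < |\mathrm{Hom}(G_n(SK_{a,b}),H)|. \]
   Context: For coprime integers $a,b$ let $T_{a,b}$ be the $(a,b)$-torus knot. For coprime positive integers $a,b$ define the square and granny knot analogues as the connect sums $SK_{a,b}=T_{a,b}\# T_{-a,b}$ and $GK_{a,b}=T_{a,b}\# T_{a,b}$. For a knot $K\subset S^3$ and $n\ge 1$, the generalised knot group $G_n(K)$ is obtained from $\pi_1(S^3-K)$ by adjoining an $n$th root of the meridian that commutes with the corresponding longitude. That is, if $\pi_1(S^3-K)=\langle g_1,\dots,g_k\mid r_1,\dots,r_\ell\rangle$ and $\mu,\lambda$ are words representing the meridian and longitude, then \[ G_n(K)=\langle g_1,\dots,g_k,\nu\mid r_1,\dots,r_\ell,\ \nu^n=\mu,\ \nu\lambda=\lambda\nu\rangle . \] (Equivalently, $G_n(K)=\pi_1(M_n(K))$, where $M_n(K)$ is obtained by gluing a torus $S^1\times S^1$ to the boundary $\mu\times\lambda$ of the exterior of $K$ by $(z_1,z_2)\mapsto(z_1^n,z_2)$.) Replacing $\lambda$ by $\mu^m\lambda$ does not change the group. Concretely, choosing integers $c,d$ with $ad-bc=1$, these groups have the presentations \[ G_n(GK_{a,b})\cong\langle x,y,w,z,\nu\mid x^a=y^b,\ w^a=z^b,\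 \nu^n=y^dx^{-c}=z^dw^{-c},\ x^aw^a\nu=\nu x^aw^a\rangle, \] \[ G_n(SK_{a,b})\cong\langle x,y,w,z,\nu\mid x^a=y^b,\ w^a=z^b,\ \nu^n=y^dx^{-c}=z^dw^{-c},\ x^aw^{-a}\nu=\nu x^aw^{-a}\rangle. \] $\mathrm{Hom}(G,H)$ is the set of group homomorphisms $G\to H$. *)

(* Defs.v *)
From HB Require Import structures.
From mathcomp Require Import all_boot all_order all_algebra all_fingroup.
From mathcomp Require Import generic_quotient.
From mathcomp Require Import boolp classical_sets functions cardinality.

Set Implicit Arguments.
Unset Strict Implicit.
Unset Printing Implicit Defensive.

Local Open Scope group_scope.
Local Open Scope quotient_scope.

(* The letter (x, true) stands for the generator x, (x, false) for x^-1. *)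
Definition word (X : Type) : Type := seq (X * bool).

Definition gen (X : Type) (x : X) : word X := [:: (x, true)].

Definition inv_word (X : Type) (w : word X) : word X :=
  rev [seq (l.1, ~~ l.2) | l <- w].

Definition map_word (X Y : Type) (f : X -> Y) (w : word X) : word Y :=
  [seq (f l.1, l.2) | l <- w].

(* A pair (u, v) in [relations] stands for the relation u = v. *)
Record presentation := Presentation {
  generators : finType;
  relations : seq (word generators * word generators)
}.

Section PresentedGroup.
Variable P : presentation.

Inductive word_equiv : word (generators P) -> word (generators P) -> Prop :=
| WE_refl u : word_equiv u u
| WE_sym u v : word_equiv u v -> word_equiv v u
| WE_trans u v w : word_equiv u v -> word_equiv v w -> word_equiv u w
| WE_cat u u' v v' :
    word_equiv u u' -> word_equiv v v' -> word_equiv (u ++ v) (u' ++ v')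
| WE_cancel x e : word_equiv [:: (x, e); (x, ~~ e)] [::]
| WE_rel r : r \in relations P -> word_equiv r.1 r.2.

Definition word_equivb (u v : word (generators P)) : bool := `[< word_equiv u v >].

Lemma word_equivb_refl : reflexive word_equivb.
Proof. by move=> u; apply/asboolP/WE_refl. Qed.

Lemma word_equivb_sym : symmetric word_equivb.
Proof.
by move=> u v; apply/asboolP/asboolP => uv; apply: WE_sym.
Qed.

Lemma word_equivb_trans : transitive word_equivb.
Proof.
by move=> v u w /asboolP uv /asboolP vw; apply/asboolP/(WE_trans uv vw).
Qed.

Definition word_equiv_rel :=
  EquivRel word_equivb word_equivb_refl word_equivb_sym word_equivb_trans.
Canonical word_equiv_rel.

Definition presented_type : Type := {eq_quot word_equiv_rel}.
HB.instance Definition _ := Choice.on presented_type.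
HB.instance Definition _ := EqQuotient.on presented_type.

Definition pg_class (u : word (generators P)) : presented_type := \pi u.

Lemma pg_classP u v : pg_class u = pg_class v <-> word_equiv u v.
Proof.
split=> [/eqP|uv]; last by apply/eqP; rewrite piE; apply/asboolP.
by rewrite piE => /asboolP.
Qed.

Lemma pg_reprK x : pg_class (repr x) = x.
Proof. by rewrite /pg_class reprK. Qed.

Lemma pg_repr_class u : word_equiv (repr (pg_class u)) u.
Proof. by apply/pg_classP; rewrite pg_reprK. Qed.

Lemma inv_wordK : involutive (@inv_word (generators P)).
Proof.
move=> w; rewrite /inv_word map_rev revK -map_comp -[RHS]map_id.
by apply: eq_map => -[x e] /=; rewrite negbK.
Qed.

Lemma inv_word_catl w : word_equiv (inv_word w ++ w) [::].
Proof.
elim: w => [|[x e] w IHw]; first exact: WE_refl.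
rewrite /inv_word /= rev_cons cat_rcons.
rewrite -[_ :: _ :: w]/([:: (x, ~~ e); (x, e)] ++ w).
apply: WE_trans IHw; apply: WE_cat; first exact: WE_refl.
rewrite -[X in word_equiv _ X]cat0s; apply: WE_cat; last exact: WE_refl.
by have := WE_cancel x (~~ e); rewrite negbK.
Qed.

Lemma inv_word_catr w : word_equiv (w ++ inv_word w) [::].
Proof. by have := inv_word_catl (inv_word w); rewrite inv_wordK. Qed.

Lemma word_equiv_inv u v :
  word_equiv u v -> word_equiv (inv_word u) (inv_word v).
Proof.
move=> uv; apply: (@WE_trans _ (inv_word u ++ (v ++ inv_word v))).
  rewrite -[X in word_equiv X _]cats0; apply: WE_cat; first exact: WE_refl.
  exact/WE_sym/inv_word_catr.
rewrite catA -[X in word_equiv _ X]cat0s; apply: WE_cat; last exact: WE_refl.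
apply: WE_trans (inv_word_catl u); apply: WE_cat; first exact: WE_refl.
exact: WE_sym.
Qed.

Definition pg_mul (x y : presented_type) : presented_type :=
  pg_class (repr x ++ repr y).
Definition pg_one : presented_type := pg_class [::].
Definition pg_inv (x : presented_type) : presented_type :=
  pg_class (inv_word (repr x)).

Lemma pg_mulE u v : pg_mul (pg_class u) (pg_class v) = pg_class (u ++ v).
Proof. by apply/pg_classP/WE_cat; apply: pg_repr_class. Qed.

Lemma pg_invE u : pg_inv (pg_class u) = pg_class (inv_word u).
Proof. exact/pg_classP/word_equiv_inv/pg_repr_class. Qed.

End PresentedGroup.

Section PresentedGroupInstance.
Variable P : presentation.
Local Notation T := (presented_type P).

Lemma pg_mulA : associative (@pg_mul P).
Proof.
move=> x y z; rewrite -(pg_reprK x) -(pg_reprK y) -(pg_reprK z).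
by rewrite !pg_mulE catA.
Qed.

Lemma pg_mul1 : left_id (pg_one P) (@pg_mul P).
Proof. by move=> x; rewrite -(pg_reprK x) /pg_one pg_mulE. Qed.

Lemma pg_mulr1 : right_id (pg_one P) (@pg_mul P).
Proof. by move=> x; rewrite -(pg_reprK x) /pg_one pg_mulE cats0. Qed.

Lemma pg_mulV : left_inverse (pg_one P) (@pg_inv P) (@pg_mul P).
Proof.
move=> x; rewrite -(pg_reprK x) pg_invE pg_mulE /pg_one.
exact/pg_classP/inv_word_catl.
Qed.

Lemma pg_mulrV : right_inverse (pg_one P) (@pg_inv P) (@pg_mul P).
Proof.
move=> x; rewrite -(pg_reprK x) pg_invE pg_mulE /pg_one.
exact/pg_classP/inv_word_catr.
Qed.

HB.instance Definition _ := isGroup.Build T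
  pg_mulA pg_mul1 pg_mulr1 pg_mulV pg_mulrV.

Definition presented_group : groupType := T.

End PresentedGroupInstance.

(* A based oriented diagram is given by its signed Gauss code: the list of the
   passages through crossings met while travelling once around the knot from
   the base point.  Every crossing is met twice, once over and once under.
   Planarity is not imposed on codes; those of [torus_knot] for coprime
   parameters and their connect sums are codes of planar diagrams. *)
Record passage (L : Type) := Passage {
  crossing : L;
  over : bool;
  positive : bool
}.

Record knot_diagram := KnotDiagram {
  crossings : eqType;
  gauss_code : seq (passage crossings)
}.

Section Wirtinger.
Variable K : knot_diagram.
Local Notation code := (gauss_code K).

(* Edge i leads to the i-th passage and edge i.+1 leaves it; the last edge,
   which ends at the base point, is identified with edge 0 by a relation. *)
Definition edge : finType := 'I_(size code).+1.

Definition over_edge (q : passage (crossings K)) : edge :=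
  inord (find (fun r => over r && (crossing r == crossing q)) code).

(* Meridians are right-handed and paths are composed from left to right, so
   that passing under edge o at a crossing of sign e contributes o^e to the
   parallel and conjugates the meridian by o^e. *)
Definition under_word (q : passage (crossings K)) : word edge :=
  [:: (over_edge q, positive q)].

Definition wirtinger_relation (iq : nat * passage (crossings K)) :
    word edge * word edge :=
  let: (i, q) := iq in
  let incoming := gen (inord i : edge) in
  let outgoing := gen (inord i.+1 : edge) in
  if over q then (outgoing, incoming)
  else (outgoing, inv_word (under_word q) ++ incoming ++ under_word q).

Definition wirtinger : presentation := Presentation
  ((gen (ord_max : edge), gen (ord0 : edge))
     :: [seq wirtinger_relation iq | iq <- zip (iota 0 (size code)) code]).

Definition meridian : word (generators wirtinger) := gen (ord0 : edge).

(* The blackboard parallel starting at the base point, multiplied by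
   meridian^(- writhe) so that its linking number with the knot is 0. *)
Definition longitude : word (generators wirtinger) :=
  let unders := [seq q <- code | ~~ over q] in
  flatten [seq under_word q | q <- unders]
    ++ [seq (ord0 : edge, ~~ positive q) | q <- unders].

End Wirtinger.

(* The connect sum is formed at the base points. *)
Definition connect_sum (K1 K2 : knot_diagram) : knot_diagram :=
  @KnotDiagram (crossings K1 + crossings K2)%type
    ([seq Passage (inl (crossing q)) (over q) (positive q) | q <- gauss_code K1]
     ++ [seq Passage (inr (crossing q)) (over q) (positive q)
           | q <- gauss_code K2]).

(* The closure of the braid on p strands with q identical levels, in each of
   which the strand in position 0 passes over all the others to position p-1,
   shifting each of them one position to the left; [pos] is the common sign of
   the crossings.  Crossing (k, i) is the one at level k with the strand that
   enters level k in position i, 0 < i < p.  For coprime p and q, the knot runs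
   through the p * q strands of the levels; starting in position 0 at level 0,
   the j-th of them is in position -j mod p at level j mod q. *)
Definition torus_code (p q : nat) (pos : bool) : seq (passage (nat * nat)) :=
  flatten [seq if (p %| j)%N
               then [seq Passage (j %% q, i)%N true pos | i <- iota 1 p.-1]
               else [:: Passage (j %% q, p - j %% p)%N false pos]
          | j <- iota 0 (p * q)].

(* T_{a,b}, for coprime a and b; the crossings are positive if a b > 0. *)
Definition torus_knot (a b : int) : knot_diagram :=
  @KnotDiagram (nat * nat)%type (torus_code `|a|%N `|b|%N (0 <= a * b)%R).

Definition GK (a b : nat) : knot_diagram :=
  connect_sum (torus_knot a%:Z b%:Z) (torus_knot a%:Z b%:Z).

Definition SK (a b : nat) : knot_diagram :=
  connect_sum (torus_knot a%:Z b%:Z) (torus_knot (- a%:Z)%R b%:Z).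

(* [None] is the adjoined root nu of the meridian. *)
Definition generalised_knot_presentation (n : nat) (K : knot_diagram) :
    presentation :=
  let lift := @map_word (generators (wirtinger K)) _ Some in
  let nu := gen (None : option (generators (wirtinger K))) in
  @Presentation (option (generators (wirtinger K)))
    ([seq (lift r.1, lift r.2) | r <- relations (wirtinger K)]
     ++ [:: (flatten (nseq n nu), lift (meridian K));
            (nu ++ lift (longitude K), lift (longitude K) ++ nu)]).

Definition generalised_knot_group (n : nat) (K : knot_diagram) : groupType :=
  presented_group (generalised_knot_presentation n K).

Definition group_homs (G H : groupType) : set (G -> H) :=
  [set f : G -> H | {morph f : x y / x * y}]%classic.
Arguments group_homs : clear implicits.

(* Main.v *)
(* Let [T(m)] be the set of colourings of T_{a,b} in H with base meridian m; it is
   parametrised by elements P, and P^b is the image of the central element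
   x^a = y^b.  Homomorphisms from G_n of the granny (square) analogue correspond
   to triples (nu, P, Q) with P, Q in T(nu^n) such that nu commutes with P^b Q^b
   (with P^b Q^-b).  As T(nu^n) is stable under conjugation by C(nu), a
   Cauchy-Schwarz argument over the cosets of C(nu) shows that for every finite H
   and every nu there are at most as many triples in the granny case, with a
   strict inequality as soon as some P1 in T(nu^n) satisfies
   P^b P1^b \notin C(nu) for all P in T(nu^n).

   To get such a P1, take a prime N > 2abn, a finite field F of characteristic N
   containing the 2ab-th roots of unity, and the unipotent shear m in GL_2(F),
   which has order N.  If P in T(m) commutes with m then P^b = m^(ab); otherwise
   P^b is scalar of determinant 1, hence 1 or -1, and -1 does occur.  So in
   GL_2(F)^2 with base meridian (m, m) the value (-1, m^(ab)) occurs, while no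
   value occurs in its inverse modulo the powers of (m, m).  As n is prime to N,
   in the wreath product of Z/n with GL_2(F)^2 the meridian (m, m) has an n-th
   root nu whose centraliser inside that of (m, m) lies over <(m, m)>. *)

From HB Require Import structures.
Require Import Defs.
From mathcomp Require Import boolp classical_sets cardinality.
From mathcomp Require Import all_boot all_fingroup all_algebra.
From mathcomp Require Import all_solvable all_field ring generic_quotient.

Set Implicit Arguments.
Unset Strict Implicit.
Unset Printing Implicit Defensive.

Local Open Scope group_scope.
Local Notation over := Defs.over.

(** * Homomorphisms from presented groups *)

Section Evaluation.
Variables (X : Type) (H : groupType).
Implicit Types (f : X -> H) (w : word X).

Definition eval f w : H := \prod_(l <- w) if l.2 then f l.1 else (f l.1)^-1.

Lemma eval_nil f : eval f [::] = 1.
Proof. exact: big_nil. Qed.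

Lemma eval_cons f l w :
  eval f (l :: w) = (if l.2 then f l.1 else (f l.1)^-1) * eval f w.
Proof. exact: big_cons. Qed.

Lemma eval_cat f w1 w2 : eval f (w1 ++ w2) = eval f w1 * eval f w2.
Proof. exact: big_cat. Qed.

Lemma eval_gen f x : eval f (gen x) = f x.
Proof. by rewrite /eval big_seq1. Qed.

Lemma eval_flatten f (ws : seq (word X)) :
  eval f (flatten ws) = \prod_(w <- ws) eval f w.
Proof.
by elim: ws => [|w ws IH]; rewrite ?big_nil ?eval_nil // big_cons eval_cat IH.
Qed.

Lemma eq_eval f1 f2 w : f1 =1 f2 -> eval f1 w = eval f2 w.
Proof. by move=> e; apply: eq_bigr => l _; rewrite e. Qed.

End Evaluation.

Lemma eval_map (X Y : Type) (H : groupType) (h : X -> Y) (f : Y -> H)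
    (w : word X) :
  eval f (map_word h w) = eval (f \o h) w.
Proof. by rewrite /eval big_map. Qed.

Lemma card_eq_finset (T : finType) (A : {set T}) :
  ([set x | x \in A]%classic #= `I_#|A|)%card.
Proof.
have -> : [set x | x \in A]%classic =
    (@enum_val T (mem A) @` [set: _]%classic)%classic.
  apply/seteqP; split=> [x xA|_ [i _ <-]]; last exact: enum_valP.
  by exists (enum_rank_in xA x); rewrite // enum_rankK_in.
have inj : {in [set: _]%classic &, injective (@enum_val T (mem A))}.
  by move=> i j _ _; apply: enum_val_inj.
by rewrite (card_eqr card_II); apply: inj_card_eq.
Qed.

Section PresentedHoms.
Variables (P : presentation) (H : finGroupType).
Implicit Types (f : generators P -> H).

Definition satisfies f : bool :=
  all (fun r => eval f r.1 == eval f r.2) (relations P).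

Lemma eval_equiv f w1 w2 :
  satisfies f -> word_equiv w1 w2 -> eval f w1 = eval f w2.
Proof.
move=> /allP sf; elim=> {w1 w2} //= [w1 w2 w3 _ -> //|||].
- by move=> w1 w1' w2 w2' _ IH1 _ IH2; rewrite !eval_cat IH1 IH2.
- move=> x e; rewrite !eval_cons eval_nil /= mulg1.
  by case: e; rewrite ?mulgV ?mulVg.
- by move=> r /sf /eqP.
Qed.

Definition pg_hom f : presented_group P -> H := fun x => eval f (repr x).

Lemma pg_hom_class f w :
  satisfies f -> pg_hom f (pg_class w) = eval f w.
Proof. by move=> sf; apply/(eval_equiv sf)/pg_repr_class. Qed.

Lemma eval_hom (h : presented_group P -> H) w :
  {morph h : x y / x * y} ->
  eval (fun x => h (pg_class (gen x))) w = h (pg_class w).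
Proof.
move=> hM; have h1 : h 1 = 1 by apply: (mulgI (h 1)); rewrite -hM !mulg1.
have hV x : h x^-1 = (h x)^-1.
  by apply: (mulgI (h x)); rewrite -hM !mulgV.
elim: w => [|[x e] w IHw]; first by rewrite eval_nil -h1.
rewrite eval_cons IHw /=.
rewrite [RHS](_ : _ = h (pg_class [:: (x, e)] * pg_class w)).
  rewrite hM; congr (_ * _); case: e => //.
  by rewrite -hV; congr h; apply: pg_invE.
by congr h; symmetry; apply: pg_mulE.
Qed.

(** Universal property of the presentation: [pg_hom] and restriction to the generators are mutually
    inverse, so counting homomorphisms amounts to counting assignments that satisfy the
    relations. *)
Lemma card_group_homs :
  (group_homs (presented_group P) H
     #= `I_#|[set f : {ffun generators P -> H} | satisfies f]|)%card.
Proof.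
set A := [set f | _].
pose B := [set f : {ffun generators P -> H} | f \in A]%classic.
pose Phi (f : {ffun generators P -> H}) := pg_hom f.
have BE (f : {ffun generators P -> H}) : B f <-> satisfies f.
  by rewrite /B /= /A inE.
have -> : group_homs (presented_group P) H = (Phi @` B)%classic.
  apply/seteqP; split=> [h hM|_ [f /BE sf <-] x y].
    exists [ffun x => h (pg_class (gen x))].
      apply/BE/allP => r rP.
      rewrite !(eq_eval _ (ffunE _)) !eval_hom //.
      by apply/eqP; congr h; apply/pg_classP/WE_rel.
    apply/funext=> x; rewrite /Phi /pg_hom (eq_eval _ (ffunE _)).
    by rewrite eval_hom // pg_reprK.
  rewrite -(pg_reprK x) -(pg_reprK y).
  rewrite [pg_class _ * _](pg_mulE (repr x) (repr y)).
  by rewrite /Phi !pg_hom_class // eval_cat.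
have inj : {in B &, injective Phi}.
  move=> f g; rewrite !in_setE => /BE sf /BE sg fg; apply/ffunP => x.
  have := congr1 (fun h => h (pg_class (gen x))) fg.
  by rewrite /Phi !pg_hom_class // !eval_gen.
exact: card_eq_trans (inj_card_eq inj) (card_eq_finset A).
Qed.

End PresentedHoms.

(** * Pairs with product or quotient in a subgroup *)

Section PairCounting.
Variables (gT : finGroupType) (C : {group gT}) (T : {set gT}) (z : gT -> gT).
Hypothesis TJ : forall c x, c \in C -> x \in T -> x ^ c \in T.
Hypothesis zJ : forall c x, c \in C -> x \in T -> z (x ^ c) = z x ^ c.

Definition product_pairs : {set gT * gT} :=
  [set w | [&& w.1 \in T, w.2 \in T & z w.1 * z w.2 \in C]].
Definition quotient_pairs : {set gT * gT} :=
  [set w | [&& w.1 \in T, w.2 \in T & z w.1 * (z w.2)^-1 \in C]].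

Let left_pairs : {set gT * gT} :=
  [set w | [&& w.1 \in T, w.2 \in T & (z w.1)^-1 * z w.2 \in C]].

Let card_left_pairs : #|left_pairs| <= #|quotient_pairs|.
Proof.
pose c (w : gT * gT) := (z w.1)^-1 * z w.2.
(* Conjugation by [(c w)^-1] turns [z w.2 = z w.1 * c w] into [c w * z w.1], hence a left quotient
   into a right one; the image determines first [w.1], then [c w], then [w.2]. *)
pose h (w : gT * gT) := (w.2 ^ (c w)^-1, w.1).
have zh w : w \in left_pairs -> z (h w).1 = c w * z w.1.
  rewrite inE => /and3P[_ w2T cC]; rewrite /h /= zJ ?groupV // /conjg invgK.
  by rewrite {2}/c invMg invgK mulKVg.
rewrite -(card_in_imset (f := h)).
  apply/subset_leq_card/subsetP => _ /imsetP[w wB ->].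
  have:= wB; rewrite !inE => /and3P[w1T w2T cC].
  by rewrite zh // w1T TJ ?groupV //= mulgK cC.
move=> w w' wB w'B hw; have e1 : w.1 = w'.1 by case: hw.
have ec : c w = c w'.
  by apply: (mulIg (z w.1)); rewrite -zh // hw zh // e1.
have e2 : w.2 = w'.2 by case: hw; rewrite ec => /conjg_inj.
by rewrite [w]surjective_pairing e1 e2 -surjective_pairing.
Qed.

(** The factors restrict [y] to the right cosets of [s] and of [t], which are equal or disjoint. *)
Let sum_cosets (s t : gT) :
  (\sum_y ((s * y^-1)%g \in C) * ((t * y^-1)%g \in C)
     = #|C| * ((s * t^-1)%g \in C))%N.
Proof.
have [stC|stC] := boolP (s * t^-1 \in C); last first.
  rewrite muln0 big1 // => y _; apply/eqP; rewrite muln_eq0 !eqb0 -negb_and.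
  apply: contra stC => /andP[syC /groupVr]; rewrite invMg invgK => /(groupM syC).
  by rewrite mulgA mulgKV.
rewrite muln1 -(card_rcoset C t) -sum1_card [RHS]big_mkcond /=.
apply: eq_bigr => y _; rewrite mem_rcoset.
have -> : s * y^-1 = s * t^-1 * (t * y^-1) by rewrite mulgA mulgKV.
by rewrite groupMl // -[y * t^-1]invgK groupV invMg invgK; case: (_ \in C).
Qed.

(** Counts over the right coset [C y]; they express the numbers of pairs as inner products, as
    needed for Cauchy-Schwarz. *)
Let r y := (\sum_(P in T) ((z P * y^-1)%g \in C))%N.
Let l y := (\sum_(P in T) (((z P)^-1 * y^-1)%g \in C))%N.

Let sum_prod (f g : gT -> gT) :
  (\sum_y (\sum_(P in T) ((f P * y^-1)%g \in C))
          * (\sum_(Q in T) ((g Q * y^-1)%g \in C))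
   = #|C| * #|[set w : gT * gT |
               [&& w.1 \in T, w.2 \in T & (f w.1 * (g w.2)^-1)%g \in C]]|)%N.
Proof.
under eq_bigr => y _ do rewrite big_distrlr /=.
rewrite exchange_big /=; under eq_bigr => P _ do rewrite exchange_big /=.
under eq_bigr => P _ do under eq_bigr => Q _ do rewrite sum_cosets.
rewrite pair_big_dep /= -big_distrr; apply: (congr1 (muln #|C|)) => /=.
rewrite big_mkcond -sum1_card [RHS]big_mkcond /=; apply: eq_bigr => w _.
by rewrite inE andbA; case: (_ && _); case: (_ \in C).
Qed.

Let sum_rr : (\sum_y r y ^ 2 = #|C| * #|quotient_pairs|)%N.
Proof. exact: sum_prod. Qed.

Let sum_ll : (\sum_y l y ^ 2 = #|C| * #|left_pairs|)%N.
Proof.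
rewrite [LHS]sum_prod; congr (_ * _)%N; apply: eq_card => w.
by rewrite !inE invgK.
Qed.

Let sum_rl : (\sum_y r y * l y = #|C| * #|product_pairs|)%N.
Proof.
rewrite [LHS]sum_prod; congr (_ * _)%N; apply: eq_card => w.
by rewrite !inE invgK.
Qed.

(* Sum [2 r l <= r^2 + l^2], where the squares add up to the numbers of
   [quotient_pairs] and [left_pairs]. *)
Lemma leq_product_pairs : #|product_pairs| <= #|quotient_pairs|.
Proof.
rewrite -(leq_pmul2l (cardG_gt0 C)) -(leq_pmul2l (ltn0Sn 1)).
rewrite -sum_rl big_distrr /= [leqRHS]mul2n -addnn.
apply: leq_trans (_ : (\sum_y (r y ^ 2 + l y ^ 2) <= _)%N).
  by apply: leq_sum => y _; apply: nat_Cauchy.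
by rewrite big_split /= sum_rr sum_ll leq_add2l leq_pmul2l.
Qed.

(** At [y = (z P1)^-1] the count [r y] vanishes by hypothesis, while [l y] is positive because it
    counts [P1]; so [2 r l <= r^2 + l^2] is strict there. *)
Lemma ltn_product_pairs (P1 : gT) :
    P1 \in T -> (forall P, P \in T -> z P * z P1 \notin C) ->
  #|product_pairs| < #|quotient_pairs|.
Proof.
move=> P1T noP; rewrite -(ltn_pmul2l (cardG_gt0 C)) -(ltn_pmul2l (ltn0Sn 1)).
rewrite -sum_rl big_distrr /= [ltnRHS]mul2n -addnn.
apply: leq_trans (_ : (\sum_y (r y ^ 2 + l y ^ 2) <= _)%N); last first.
  by rewrite big_split /= sum_rr sum_ll leq_add2l leq_pmul2l.
rewrite (bigD1 (z P1)^-1) //= [ltnRHS](bigD1 (z P1)^-1) //= -addSn.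
apply: leq_add; last by apply: leq_sum => y _; apply: nat_Cauchy.
have -> : r (z P1)^-1 = 0%N.
  by apply: big1 => P /noP; rewrite invgK => /negPf ->.
rewrite mul0n muln0 add0n expn_gt0 orbF /l (bigD1 P1) //=.
by rewrite invgK mulVg group1.
Qed.

End PairCounting.

(** * Wreath products *)

Section WreathProduct.
Variables gT aT : finGroupType.

(** The regular wreath product: [gT] acts on the functions by left translation. *)
Definition wreath : Type := {ffun gT -> aT} * gT.
HB.instance Definition _ := Finite.on wreath.

Definition wreath_mul (w1 w2 : wreath) : wreath :=
  ([ffun x => w1.1 x * w2.1 (w1.2^-1 * x)], w1.2 * w2.2).
Definition wreath_one : wreath := ([ffun=> 1], 1).
Definition wreath_inv (w : wreath) : wreath :=
  ([ffun x => (w.1 (w.2 * x))^-1], w.2^-1).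

Lemma wreath_mulA : associative wreath_mul.
Proof.
move=> [f1 g1] [f2 g2] [f3 g3]; congr pair; last exact: mulgA.
by apply/ffunP => x; rewrite !ffunE /= invMg !mulgA.
Qed.

Lemma wreath_mul1 : left_id wreath_one wreath_mul.
Proof.
move=> [f g]; congr pair; last exact: mul1g.
by apply/ffunP => x; rewrite !ffunE invg1 !mul1g.
Qed.

Lemma wreath_mulV : left_inverse wreath_one wreath_inv wreath_mul.
Proof.
move=> [f g]; congr pair; last exact: mulVg.
by apply/ffunP => x; rewrite !ffunE /= invgK mulVg.
Qed.

HB.instance Definition _ :=
  Finite_isGroup.Build wreath wreath_mulA wreath_mul1 wreath_mulV.

Lemma wreath_mulE (w1 w2 : wreath) : w1 * w2 = wreath_mul w1 w2.
Proof. by []. Qed.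

End WreathProduct.

(** * Colourings of torus knots with a given base meridian *)

Lemma card_pair_sum (A B : finType) (S : A -> {set B}) :
  #|[set w : A * B | w.2 \in S w.1]| = (\sum_a #|S a|)%N.
Proof.
under eq_bigr do rewrite -sum1_card.
rewrite (pair_big_dep xpredT (fun a => mem (S a))) -sum1_card /=.
by apply: eq_bigl => w; rewrite inE.
Qed.

Section TorusSet.
Variables (p q u v : nat).
Hypothesis up : (u * p = (q * v).+1)%N.

(* With [p = a] and [q = b], [P] is the product of [p] consecutive over-arcs of
   a colouring with base meridian [m]; then [P ^+ q] is the image of the central
   element [x^a = y^b].  Given [up], the second condition reads
   [P = (m * P ^- u) ^+ p * P ^+ (u * p)]. *)
Definition torus_set (gT : finGroupType) (m : gT) : {set gT} :=
  [set P | (P ^+ q * m == m * P ^+ q) &&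
           ((m * P ^- u) ^+ p * P ^+ (q * v) == 1)].

Section Basics.
Variable gT : finGroupType.
Implicit Types (m P : gT).

Lemma torus_setP m P :
  reflect (commute (P ^+ q) m /\ (m * P ^- u) ^+ p * P ^+ (q * v) = 1)
          (P \in torus_set m).
Proof. by rewrite inE; apply: (iffP andP) => -[/eqP ? /eqP ?]. Qed.

Lemma torus_setJ m P g : P \in torus_set m -> P ^ g \in torus_set (m ^ g).
Proof.
move=> /torus_setP[cPm e]; apply/torus_setP; split.
  by rewrite /commute -conjXg -!conjMg cPm.
by rewrite -!conjXg -conjVg -conjMg -conjXg -conjMg e conj1g.
Qed.

(** The relation for the inverses involves [m^-1 * P ^+ u], a conjugate of [(m * P ^- u)^-1] by a
    power of [P]. *)
Lemma torus_setV m P : P \in torus_set m -> P^-1 \in torus_set m^-1.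
Proof.
move=> /torus_setP[cPm e]; apply/torus_setP; split.
  by rewrite expgVn; apply/commuteV/commute_sym/commuteV/commute_sym.
have {e} e : (P ^+ u * m^-1) ^+ p = P ^+ (q * v).
  apply: invg_inj; rewrite -expgVn invMg invgK; apply: (mulIg (P ^+ (q * v))).
  by rewrite e mulVg.
rewrite !expgVn invgK [m^-1 * _](_ : _ = (P ^+ u * m^-1) ^ (P ^+ u)).
  rewrite -conjXg e conjgE (commuteX2 (q * v) u (commute_refl P)).
  by rewrite mulKg mulgV.
by rewrite conjgE -mulgA mulKg.
Qed.

Lemma torus_setVE m P : (P^-1 \in torus_set m^-1) = (P \in torus_set m).
Proof. by apply/idP/idP => /torus_setV; rewrite ?invgK. Qed.

(** This is the constant colouring, where all over-arcs have colour [m]. *)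
Lemma torus_set_pow m : m ^+ p \in torus_set m.
Proof.
apply/torus_setP; split; first exact/commute_sym/commuteX/commuteX.
rewrite -!expgM mulnC up expgS invMg.
have cm : commute (m ^- (q * v)) m^-1.
  by apply/commuteV/commute_sym/commuteV/commuteX.
rewrite cm mulgA mulgV mul1g expgVn -expgM.
by rewrite mulnC mulnA mulVg.
Qed.

(** For commuting [P] and [m] the second condition collapses to [m ^+ p * P^-1 = 1], by [up]. *)
Lemma torus_set_abelian m P :
  P \in torus_set m -> commute P m -> P = m ^+ p.
Proof.
move=> /torus_setP[_ e] cPm; apply: (mulIg P^-1); rewrite mulgV -e.
have cmV : commute m (P ^- u) by exact/commuteV/commuteX/commute_sym.
by rewrite expgMn // expgVn -expgM up expgSr invMg -!mulgA mulVg mulg1.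
Qed.

Lemma torus_set_abelian_exp m P :
  P \in torus_set m -> commute P m -> P ^+ q = m ^+ (p * q).
Proof. by move=> PT cP; rewrite {1}(torus_set_abelian PT cP) expgM. Qed.

(** Here [R] plays the role of [P ^- u], and [P = c ^+ v * R ^- p] recovers [P] from it. The search
    for [P] becomes a search for [R] such that [R] and [m * R] have prescribed central powers. *)
Lemma torus_set_central m R c :
    commute c R -> commute c m -> c ^+ 2 = 1 ->
    R ^+ q = c ^+ u -> (m * R) ^+ p = c ^+ v ->
  exists2 P, P \in torus_set m & P ^+ q = c.
Proof.
move=> cR cm c2 Rq mRp; pose P := c ^+ v * R ^- p.
have cRX i j : commute (c ^+ i) (R ^- j).
  by apply/commuteV/commuteX2.
have cX2 i : c ^+ (i + i) = 1 by rewrite addnn -mul2n expgM c2 expg1n.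
have RqX i : R ^+ (q * i) = c ^+ (u * i) by rewrite !expgM Rq.
have Pq : P ^+ q = c.
  rewrite expgMn // expgVn -!expgM [(p * q)%N]mulnC RqX up.
  apply: (mulIg (c ^+ (q * v).+1)); rewrite mulgKV -expgS.
  by rewrite -[(q * v).+2]addn2 expgnDr c2 mulg1 mulnC.
have Pu : P ^- u = R.
  apply: invg_inj; rewrite invgK expgMn // expgVn -!expgM [(p * u)%N]mulnC up.
  rewrite expgS RqX invMg -expgVn [(v * u)%N]mulnC.
  have -> : c^-1 = c by apply: (mulgI c); rewrite mulgV -c2 expgS expg1.
  by rewrite mulgA -expgnDr cX2 mul1g.
exists P => //; apply/torus_setP; rewrite Pq Pu expgM Pq mRp; split=> //.
by rewrite -expgnDr cX2.
Qed.

End Basics.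

Lemma torus_set_morph (gT hT : finGroupType) (f : gT -> hT) m P :
    {morph f : x y / x * y} -> P \in torus_set m -> f P \in torus_set (f m).
Proof.
move=> fM /torus_setP[cPm e].
have f1 : f 1 = 1 by apply: (mulgI (f 1)); rewrite -fM !mulg1.
have fX x k : f (x ^+ k) = f x ^+ k.
  by elim: k => [|k IHk]; rewrite // !expgS fM IHk.
have fV x : f x^-1 = (f x)^-1.
  by apply: (mulgI (f x)); rewrite -fM !mulgV.
by apply/torus_setP; rewrite /commute -!fX -fV -!fM cPm -fX -fM e f1.
Qed.

Lemma pair_expg (gT hT : finGroupType) (w : gT * hT) k :
  w ^+ k = (w.1 ^+ k, w.2 ^+ k).
Proof. by elim: k => [|k IHk] //; rewrite !expgS IHk. Qed.

Lemma torus_set_pair (gT hT : finGroupType) (m P : gT) (m' P' : hT) :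
    P \in torus_set m -> P' \in torus_set m' ->
  (P, P') \in torus_set (m, m').
Proof.
move=> /torus_setP[cP eP] /torus_setP[cP' eP']; apply/torus_setP.
by rewrite !pair_expg; split; [apply: congr2 cP cP' | apply: congr2 eP eP'].
Qed.

(* The pair [(P0, m ^+ p)] takes the central element to [(c, m ^+ (p * q))],
   whose coordinates are not inverted by any common power of [m]. *)
Lemma torus_set_asymmetric (gT : finGroupType) (m c P0 : gT) :
    (forall P, P \in torus_set m ->
       [\/ P ^+ q = 1, P ^+ q = c | P ^+ q = m ^+ (p * q)]) ->
    P0 \in torus_set m -> P0 ^+ q = c ->
    c ^+ 2 = 1 -> c \notin <[m]> -> m ^+ (2 * (p * q)) != 1 ->
  exists2 P1 : gT * gT, P1 \in torus_set (m, m) &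
    forall P, P \in torus_set (m, m) -> P ^+ q * P1 ^+ q \notin <[(m, m)]>.
Proof.
move=> Tz P0T P0q c2 c_m m2; exists (P0, m ^+ p).
  exact/torus_set_pair/torus_set_pow.
move=> P PT; apply/negP => /cycleP[j].
rewrite !pair_expg => -[]; rewrite P0q -expgM => e1 e2.
(* In the first coordinate the values 1 and [m ^+ (p * q)] would put [c] into [<[m]>]; the value [c]
   gives [c ^+ 2 = 1]. *)
have mj1 : m ^+ j = 1.
  have [z1|z1|z1] := Tz _ (torus_set_morph (f := fst) (fun _ _ => erefl) PT).
  - by move: c_m; rewrite -[c]mul1g -z1 e1 mem_cycle.
  - by rewrite -e1 z1 -c2 expgS expg1.
  - case/negP: c_m; rewrite -(groupMl _ (mem_cycle m (p * q))).
    by rewrite -z1 e1 mem_cycle.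
(* The second coordinate must now invert [m ^+ (p * q)], which each of the three values
   contradicts. *)
move: e2; rewrite mj1.
have [->|->|->] := Tz _ (torus_set_morph (f := snd) (fun _ _ => erefl) PT).
- by rewrite mul1g => e; case/eqP: m2; rewrite mulnC expgM e expg1n.
- move=> e; case/negP: c_m; rewrite -(groupMr _ (mem_cycle m (p * q))) e.
  exact: group1.
- by rewrite -expgnDr addnn -mul2n => e; rewrite e eqxx in m2.
Qed.

(** * Comparing granny and square triples in one group *)

Section Triples.
Variables (gT : finGroupType) (n : nat).

(* The second colouring of the square knot analogue comes from the mirror
   image, so it has base meridian [nu ^- n]. *)
Definition granny_triples : {set gT * (gT * gT)} :=
  [set w | [&& w.2.1 \in torus_set (w.1 ^+ n), w.2.2 \in torus_set (w.1 ^+ n)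
             & w.2.1 ^+ q * w.2.2 ^+ q \in 'C[w.1]]].
Definition square_triples : {set gT * (gT * gT)} :=
  [set w | [&& w.2.1 \in torus_set (w.1 ^+ n), w.2.2 \in torus_set (w.1 ^- n)
             & w.2.1 ^+ q * w.2.2 ^+ q \in 'C[w.1]]].

(** The triples are counted fibrewise over the root of the meridian: the fibre over [nu] gives a
    strict inequality, every other fibre a weak one. *)
Lemma ltn_granny_square (nu P1 : gT) :
    P1 \in torus_set (nu ^+ n) ->
    (forall P, P \in torus_set (nu ^+ n) -> P ^+ q * P1 ^+ q \notin 'C[nu]) ->
  #|granny_triples| < #|square_triples|.
Proof.
move=> P1T noP.
pose T (x : gT) := torus_set (x ^+ n); pose z (P : gT) := P ^+ q.
have TJ x c P : c \in 'C[x] -> P \in T x -> P ^ c \in T x.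
  move=> /cent1P cx PT; rewrite /T -[x](_ : x ^ c = x).
    by rewrite -conjXg torus_setJ.
  by rewrite conjgE -cx mulKg.
have zJ c P : z (P ^ c) = z P ^ c by rewrite /z conjXg.
have -> : #|granny_triples| = (\sum_x #|product_pairs 'C[x] (T x) z|)%N.
  by rewrite -card_pair_sum; apply: eq_card => w; rewrite !inE.
have -> : #|square_triples| = (\sum_x #|quotient_pairs 'C[x] (T x) z|)%N.
  rewrite -card_pair_sum.
  (* Inverting the second colouring changes its base meridian from the inverse of [x ^+ n] to
     [x ^+ n] and the product of central values into a quotient. *)
  pose h (w : gT * (gT * gT)) := (w.1, (w.2.1, w.2.2^-1)).
  have hK : involutive h by case=> x [P Q]; rewrite /h /= invgK.
  rewrite -(card_imset _ (inv_inj hK)); apply: eq_card => w.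
  rewrite -[w]hK (mem_imset _ _ (inv_inj hK)) [LHS]in_set /= torus_setVE.
  by rewrite hK [RHS]in_set [RHS]in_set /z expgVn.
rewrite (bigD1 nu) //= [ltnRHS](bigD1 nu) //= -addSn; apply: leq_add.
  exact: ltn_product_pairs (TJ nu) (fun c P _ _ => zJ c P) P1 P1T noP.
apply: leq_sum => x _.
exact: leq_product_pairs (TJ x) (fun c P _ _ => zJ c P).
Qed.

End Triples.

(** * Shrinking the centraliser by a wreath product *)

Section CycleCriterion.
Variables (gT aT : finGroupType) (n : nat) (m P1 : gT) (s : aT).
Hypotheses (n_gt0 : 0 < n) (co_mn : coprime #[m] n).
Hypotheses (sn1 : s ^+ n = 1) (s1 : s != 1).
Hypothesis P1T : P1 \in torus_set m.
Hypothesis noP : forall P, P \in torus_set m -> P ^+ q * P1 ^+ q \notin <[m]>.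

Let W := wreath gT aT.
Let emb (g : gT) : W := ([ffun=> 1], g).

Let embM : {morph emb : g h / g * h}.
Proof.
move=> g h; rewrite wreath_mulE /wreath_mul /=; congr pair.
by apply/ffunP => x; rewrite !ffunE mulg1.
Qed.

Let sndM : {morph (fun w : W => w.2) : w1 w2 / w1 * w2}.
Proof. by []. Qed.

(* As [#[m]] is prime to [n], [m] has an [n]-th root [m ^+ k] in [<[m]>];
   multiplying it by the [n]-torsion function supported on [<[m]>] shrinks its
   centraliser inside ['C[m]] to a group over [<[m]>]. *)
Lemma wreath_ltn_granny_square :
  #|granny_triples W n| < #|square_triples W n|.
Proof.
have [k kn] : exists k, m ^+ (k * n) = m.
  case: (egcdnP #[m] n_gt0) => k r + _; rewrite gcdnC (eqP co_mn) => e.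
  by exists k; rewrite e expgnDr mulnC expgM expg_order expg1n mul1g.
pose chi := [ffun x => if x \in <[m]> then s else 1] : {ffun gT -> aT}.
pose nu : W := (chi, m ^+ k).
(* Translation by powers of [m] fixes [chi], so its powers are pointwise. *)
have nuX i : nu ^+ i = ([ffun x => chi x ^+ i], m ^+ (k * i)) :> W.
  elim: i => [|i IHi].
    by rewrite muln0; congr pair; apply/ffunP => x; rewrite !ffunE.
  rewrite expgS IHi wreath_mulE /wreath_mul /= mulnS expgnDr.
  congr pair; apply/ffunP => x.
  by rewrite !ffunE /= expgS groupMl ?groupV ?mem_cycle.
have nun : nu ^+ n = emb m.
  rewrite nuX kn; congr pair; apply/ffunP => x; rewrite !ffunE.
  by case: ifP => _; rewrite ?sn1 ?expg1n.
apply: (@ltn_granny_square _ _ nu (emb P1)).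
  by rewrite nun; apply: torus_set_morph.
rewrite nun => P PT; apply/negP => /cent1P; set z := _ * _ => znu.
have /torus_setP[cP _] := PT.
have /torus_setP[cP1 _] := torus_set_morph embM P1T.
have zm : commute z (emb m).
  by apply/commute_sym/commuteM; apply/commute_sym.
have sndX (w : W) i : (w ^+ i).2 = w.2 ^+ i.
  by elim: i => [|i IHi] //; rewrite !expgS sndM IHi.
have := noP (torus_set_morph sndM PT); rewrite /= -sndX.
rewrite -[P1]/((emb P1).2) -sndX -sndM -/z; clearbody z.
(* Commuting with [emb m] makes the function part of [z] invariant under translation by [m]. *)
have az x : z.1 (m^-1 * x) = z.1 x.
  have /ffunP/(_ x) := congr1 fst zm.
  by rewrite !ffunE /= mulg1 mul1g.
have azX i x : z.1 (m ^- i * x) = z.1 x.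
  elim: i => [|i IHi]; first by rewrite invg1 mul1g.
  by rewrite expgSr invMg -mulgA az IHi.
(* At 1 the commutation with [nu] reads [z.1 1 * chi z.2^-1 = s * z.1 1]; for [z.2] outside [<[m]>]
   this forces [s = 1]. *)
have /ffunP/(_ 1) := congr1 fst znu.
rewrite !ffunE /= azX group1 mulg1 groupV.
case: ifP => // _; rewrite mulg1 => /eqP.
by rewrite eq_sym -{2}[z.1 1]mul1g (inj_eq (mulIg _)) (negPf s1).
Qed.

End CycleCriterion.
End TorusSet.

(** * A finite linear group *)

Section LinearGroups.
Import GRing.Theory.
Local Open Scope ring_scope.

(** By Euler's theorem [r] divides [N ^ totient r - 1], the order of the cyclic unit group of the
    field with [N ^ totient r] elements. *)
Lemma exists_prim_root (N r : nat) :
  prime N -> coprime N r -> (1 < r)%N ->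
  exists F : finFieldType, N \in [pchar F] /\ exists w : F, r.-primitive_root w.
Proof.
move=> N_pr co_Nr r_gt1.
have [F chF cardF] :
    {F : finFieldType & N \in [pchar F] & #|F| = N ^ totient r}%N.
  have t_gt0 : (0 < totient r)%N by rewrite totient_gt0 ltnW.
  by have [F chF cF] := PrimePowerField N_pr t_gt0; exists F.
exists F; split=> //.
have r_dv : (r %| #|F|.-1)%N.
  rewrite cardF -subn1 -eqn_mod_dvd ?expn_gt0 ?prime_gt0 //.
  exact/eqP/Euler_exp_totient.
have F_gt1 := finNzRing_gt1 F.
have F1 : (0 < #|F|.-1)%N by rewrite -ltnS prednK // ltnW.
pose rs := [seq x <- enum F | x != 0].
have /hasP[w _ w_pr] : has (#|F|.-1).-primitive_root rs.
  apply: has_prim_root => //.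
  - apply/allP => x; rewrite mem_filter => /andP[x0 _]; apply/unity_rootP.
    by apply: (mulfI x0); rewrite -exprS prednK ?expf_card ?mulr1 // ltnW.
  - by rewrite filter_uniq ?enum_uniq.
  - by rewrite -(cardC1 (0 : F)) cardE /enum_mem size_filter /rs size_filter
      enumT; apply/eq_leq/eq_count => x; rewrite !inE.
by exists (w ^+ (#|F|.-1 %/ r)); apply: dvdn_prim_root.
Qed.

(** * Two-by-two matrices with scalar powers *)

Section Matrices.
Variable F : fieldType.
Implicit Types (A : 'M[F]_2) (t d e : F).

Definition mx22 (a b c d : F) : 'M[F]_2 :=
  \matrix_(i, j) if i == 0 then (if j == 0 then a else b)
                 else (if j == 0 then c else d).

Lemma mx22P A : A = mx22 (A 0 0) (A 0 1) (A 1 0) (A 1 1).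
Proof.
apply/matrixP => i j; rewrite mxE.
by case: i j => [[|[|i]] ?] [[|[|j]] ?] //=; congr (A _ _); apply: val_inj.
Qed.

Lemma mx22_inj a b c d a' b' c' d' :
  mx22 a b c d = mx22 a' b' c' d' -> [/\ a = a', b = b', c = c' & d = d'].
Proof.
move/matrixP => e; have := (e 0 0, e 0 1, e 1 0, e 1 1).
by rewrite !mxE /= => -[[[]]].
Qed.

Lemma mul_mx22 a b c d a' b' c' d' :
  mx22 a b c d * mx22 a' b' c' d'
  = mx22 (a * a' + b * c') (a * b' + b * d') (c * a' + d * c') (c * b' + d * d').
Proof.
apply/matrixP => i j; rewrite !mxE !big_ord_recl big_ord0 !mxE addr0 /=.
by case: (i == 0); case: (j == 0).
Qed.

Lemma det_mx22 a b c d : \det (mx22 a b c d) = a * d - b * c.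
Proof.
rewrite (expand_det_row _ 0) !big_ord_recl big_ord0 addr0 /cofactor !det_mx11.
by rewrite !mxE /= expr0 expr1 mul1r mulN1r mulrN.
Qed.

(* Trace [t] and determinant 1; left multiplication by the shear preserves the
   second row. *)
Definition companion t d : 'M[F]_2 := mx22 t (- d^-1) d 0.

Lemma shear_companion t d :
  d != 0 -> mx22 1 1 0 1 * companion t d = companion (t + d) d.
Proof.
by move=> d0; rewrite mul_mx22 !mul1r !mul0r !add0r ?addr0.
Qed.

(** The eigenvalues are [e] and [e^-1], distinct by [e ^+ 2 != 1]; both have [k]-th power [s], as
    [s ^+ 2 = 1]. *)
Lemma companion_exp e d k (s : F) :
    e != 0 -> d != 0 -> e ^+ 2 != 1 -> s ^+ 2 = 1 -> e ^+ k = s ->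
  companion (e + e^-1) d ^+ k = s%:M.
Proof.
move=> e0 d0 e2 s2 ek; set M := companion _ _.
have MM : M * M = (e + e^-1) *: M - 1.
  rewrite [RHS]mx22P /M /companion mul_mx22 !mxE /= ?mulr1n ?mulr0n.
  by congr mx22; field; rewrite ?e0 ?d0.
(* By Cayley-Hamilton, [M] acts on the columns of [M - y] as multiplication by [x]. *)
have eigen (x y : F) : x + y = e + e^-1 -> x * y = 1 ->
    forall i, M ^+ i * (M - y%:M) = x ^+ i *: (M - y%:M).
  move=> xy_s xy1; elim=> [|i IHi]; first by rewrite mul1r scale1r.
  rewrite exprSr -mulrA exprS -scalerA -IHi scalerAr; congr (_ * _).
  rewrite mulrBr MM -xy_s scalerBr -[y%:M]scalemx1 -scalerAr mulr1.
  by rewrite scalerA xy1 scale1r scalerDl addrAC addrK.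
have ek' : e^-1 ^+ k = s.
  have s0 : s != 0.
    by apply: contra_eq_neq s2 => ->; rewrite expr0n eq_sym oner_eq0.
  by rewrite exprVn ek; apply: (mulIf s0); rewrite mulVf // -expr2 s2.
have := eigen e e^-1 erefl (mulfV e0) k.
have := eigen e^-1 e (addrC _ _) (mulVf e0) k.
(* Subtracting the two eigenvalue identities leaves the scalar [e - e^-1], which is nonzero and
   cancels. *)
rewrite ek ek' => e1 e2'; have : M ^+ k * (e - e^-1)%:M = s *: (e - e^-1)%:M.
  rewrite raddfB /=.
  have -> : e%:M - e^-1%:M = (M - e^-1%:M) - (M - e%:M).
    by rewrite opprB [RHS]addrC addrA subrK.
  by rewrite mulrBr e1 e2' [RHS]scalerBr.
rewrite -scalemx1 -scalerAr mulr1 scalerA mulrC -scalerA scalemx1.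
move/scalerI; apply.
rewrite subr_eq0; apply: contra e2 => /eqP ee; apply/eqP.
by rewrite expr2 {1}ee mulVf.
Qed.

End Matrices.

(** By [up], [P = (m * P ^- u) ^+ p * (P ^+ u) ^+ p], and commutativity in [R] collapses the image
    to [f m ^+ p]. It is applied to the determinant. *)
Lemma torus_set_multiplicative (p q u v : nat) (gT : finGroupType)
    (R : comNzRingType) (f : gT -> R) (m P : gT) :
    (u * p = (q * v).+1)%N -> {morph f : x y / (x * y)%g >-> x * y} ->
    f 1%g = 1 -> f m = 1 ->
  P \in torus_set p q u v m -> f P = 1.
Proof.
move=> up fM f1 fm /torus_setP[_ e].
have fX g k : f (g ^+ k)%g = f g ^+ k.
  by elim: k => [|k IHk]; rewrite // expgS fM IHk exprS.
have := congr1 (fun g => f (g * P)%g) e.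
rewrite mul1g => <-; rewrite -mulgA -expgSr -up expgM.
have cV : f (m * P ^- u)%g * f (P ^+ u)%g = 1 by rewrite -fM mulgKV.
by rewrite fM (fX _ p) (fX (P ^+ u)%g p) -exprMn cV expr1n.
Qed.

(* [{'GL_2[F]}] only enters through an injective representation [V] whose image
   contains the matrices of determinant 1. *)
Section LinearWitness.
Variables (F : finFieldType) (N p q u v : nat) (w : F).
Hypotheses (p_gt1 : (1 < p)%N) (q_gt1 : (1 < q)%N).
Hypothesis up : (u * p = (q * v).+1)%N.
Hypotheses (chF : N \in [pchar F]) (N_gt : (2 * (p * q) < N)%N).
Hypothesis w_prim : (2 * (p * q)).-primitive_root w.
Variables (gl : finGroupType) (V : gl -> 'M[F]_2).
Hypotheses (V_inj : injective V) (V1 : V 1%g = 1).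
Hypothesis VM : {morph V : x y / (x * y)%g >-> x * y}.
Variables (shear c : gl).
Hypotheses (Vshear : V shear = mx22 1 1 0 1) (Vc : V c = (-1)%:M).
Hypothesis V_det1 : forall A, \det A = 1 -> exists g, V g = A.

Let VX g k : V (g ^+ k)%g = V g ^+ k.
Proof. by elim: k => [|k IHk]; rewrite ?V1 // expgS VM IHk exprS. Qed.

Let natF0 k : (0 < k < N)%N -> k%:R != 0 :> F.
Proof.
move=> /andP[k0 kN]; rewrite -(dvdn_pcharf chF).
by apply/negP => /(dvdn_leq k0); rewrite leqNgt kN.
Qed.

Let pq_gt0 : (0 < p * q)%N.
Proof. by rewrite muln_gt0 (ltnW p_gt1) (ltnW q_gt1). Qed.

Let two_neq0 : 2%:R != 0 :> F.
Proof.
by apply: natF0; rewrite (leq_ltn_trans _ N_gt) // leq_pmulr.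
Qed.

Let opp1_neq1 : -1 != 1 :> F.
Proof. by rewrite -subr_eq0 -opprD oppr_eq0 -[1 + 1]/(2%:R). Qed.

Let V_shearX k : V (shear ^+ k)%g = mx22 1 k%:R 0 1.
Proof.
elim: k => [|k IHk]; first by rewrite V1 [LHS]mx22P !mxE.
rewrite expgS VM Vshear IHk mul_mx22.
by rewrite !(mul0r, mulr0, mul1r, mulr1, add0r, addr0) -natr1.
Qed.

Lemma order_shear : (#[shear]%g %| N)%N.
Proof.
rewrite order_dvdn; apply/eqP/V_inj; rewrite V_shearX.
by rewrite (pcharf0 chF) -[0]/(0%:R) -V_shearX.
Qed.

Local Notation T := (torus_set p q u v).

Let V_cX k : V (c ^+ k)%g = ((-1) ^+ k)%:M.
Proof. by rewrite VX Vc rmorphXn. Qed.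

Let sign2 k : ((-1) ^+ k) ^+ 2 = 1 :> F.
Proof. by rewrite exprAC sqrrN !expr1n. Qed.

(** Since [P ^+ q] commutes with the shear and has determinant 1, it is upper triangular with equal
    diagonal entries 1 or -1. A nonzero corner entry would make [P], which commutes with [P ^+ q],
    commute with the shear. *)
Lemma torus_set_shear (P : gl) : P \in T shear ->
  [\/ P ^+ q = 1, P ^+ q = c | P ^+ q = shear ^+ (p * q)]%g.
Proof.
move=> PT; have /torus_setP[cz _] := PT.
have [/eqP cP|ncP] := boolP ((P * shear)%g == (shear * P)%g).
  exact/Or33/(torus_set_abelian_exp up PT cP).
have cPz : V P * V (P ^+ q)%g = V (P ^+ q)%g * V P.
  by rewrite -!VM; congr V; apply: commuteX.
have [det1g detM] : \det (V 1%g) = 1 /\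
    {morph (fun g => \det (V g)) : x y / (x * y)%g >-> x * y}.
  by split=> [|x y]; rewrite ?V1 ?det1 // VM detM.
have dP : \det (V P) = 1.
  apply: (torus_set_multiplicative (m := shear) up detM) PT => //.
  by rewrite Vshear det_mx22 mulr0 subr0 mulr1.
have dz : \det (V (P ^+ q)%g) = 1.
  by elim: (q) => [|k IHk]; rewrite // expgS detM IHk dP mulr1.
have cmz : mx22 1 1 0 1 * V (P ^+ q)%g = V (P ^+ q)%g * mx22 1 1 0 1.
  by rewrite -Vshear -!VM cz.
suff [z1|z1] : V (P ^+ q)%g = 1 \/ V (P ^+ q)%g = (-1)%:M.
- by apply: Or31; apply: V_inj; rewrite V1.
- by apply: Or32; apply: V_inj; rewrite Vc.
move: (V (P ^+ q)%g) cPz dz cmz => Z; rewrite [Z]mx22P /=.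
move: (Z 0 0) (Z 0 1) (Z 1 0) (Z 1 1) => a b c0 d cPz.
rewrite det_mx22 !mul_mx22 !(mul0r, mulr0, mul1r, mulr1, add0r, addr0).
move=> dz /mx22_inj[/(canRL (addKr _))].
rewrite addNr [b + d]addrC => c00 /addIr da _ _.
move: cPz dz; rewrite {c0}c00 {d}da.
have [->|b0] := eqVneq b 0.
  rewrite mulr0 subr0 -expr2 => _ /eqP; rewrite sqrf_eq1 => /orP[]/eqP->.
    by left; rewrite [RHS]mx22P !mxE.
  by right; rewrite [RHS]mx22P !mxE.
move=> cPz _; case/eqP: ncP; apply: V_inj; rewrite !VM Vshear.
move: (V P) cPz => X; rewrite [X]mx22P.
move: (X 0 0) (X 0 1) (X 1 0) (X 1 1) => e0 f0 g0 h0.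
rewrite !mul_mx22 !(mul0r, mulr0, mul1r, mulr1, add0r, addr0).
case/mx22_inj => + + _ _; rewrite mulrC => /esym/eqP.
rewrite -subr_eq0 addrAC subrr add0r mulf_eq0 (negPf b0) /= => /eqP->.
rewrite [f0 * a]mulrC [RHS]addrC => /addIr; rewrite mulrC => /(mulfI b0) ->.
by rewrite addr0 add0r addrC.
Qed.

Let w_neq0 : w != 0.
Proof.
have := prim_expr_order w_prim; apply: contra_eq_neq => ->.
by rewrite expr0n muln_eq0 /= eqn0Ngt pq_gt0 eq_sym oner_eq0.
Qed.

(** Apply [torus_set_central] to a companion matrix [R] of trace [h + h^-1], with [d] chosen so that
    [shear * R] has trace [e + e^-1]. As [w ^+ (p * q) = -1], the exponents of [h] and [e] give
    [R ^+ q = (-1) ^+ u] and [(shear * R) ^+ p = (-1) ^+ v]. *)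
Lemma exists_torus_set_shear :
  exists2 P : gl, P \in T shear & (P ^+ q)%g = c.
Proof.
have w_half : w ^+ (p * q) = -1.
  have : w ^+ (p * q) ^+ 2 == 1.
    by rewrite -exprM mulnC (prim_expr_order w_prim).
  rewrite sqrf_eq1 => /orP[|/eqP //].
  rewrite -(prim_order_dvd w_prim) => /(dvdn_leq pq_gt0).
  by rewrite leqNgt ltn_Pmull.
pose e := w ^+ (q * v); pose h := w ^+ (u * p).
have hwe : h = w * e by rewrite /h up exprS.
have e0 : e != 0 by rewrite expf_neq0.
have h0 : h != 0 by rewrite expf_neq0.
(* Otherwise [p] divides [v], hence 1 by [up]; likewise [h ^+ 2 = 1] would make [q] divide [u]. *)
have e2 : e ^+ 2 != 1.
  rewrite -exprM -(prim_order_dvd w_prim) mulnC dvdn_pmul2r //.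
  rewrite [(p * q)%N]mulnC dvdn_pmul2l ?(ltnW q_gt1) //; apply/negP => p_v.
  have : (p %| 1)%N.
    by rewrite -(dvdn_addr 1 (dvdn_mull q p_v)) addn1 -up dvdn_mull.
  by rewrite dvdn1 => /eqP p1; move: p_gt1; rewrite p1.
have h2 : h ^+ 2 != 1.
  rewrite -exprM -(prim_order_dvd w_prim) mulnC dvdn_pmul2r //.
  rewrite [(p * q)%N]mulnC dvdn_pmul2r ?(ltnW p_gt1) //; apply/negP => q_u.
  have : (q %| 1)%N.
    by rewrite -(dvdn_addr 1 (dvdn_mulr v (dvdnn q))) addn1 -up dvdn_mulr.
  by rewrite dvdn1 => /eqP q1; move: q_gt1; rewrite q1.
have d0 : e + e^-1 - (h + h^-1) != 0.
  (* Here [h = w * e] differs from [e], and [e * h] is an odd power of [w], whose order is even. *)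
  have -> : e + e^-1 - (h + h^-1) = (e - h) * (e * h - 1) / (e * h).
    by field; rewrite e0 h0.
  rewrite !mulf_neq0 ?invr_eq0 ?mulf_neq0 // subr_eq0.
    rewrite hwe -[eqbLHS]mul1r (inj_eq (mulIf e0)) eq_sym -[w]expr1.
    by rewrite -(prim_order_dvd w_prim) dvdn1 muln_eq1.
  rewrite hwe mulrCA -expr2 -exprM -exprS -(prim_order_dvd w_prim).
  apply/negP => /(dvdn_trans (dvdn_mulr _ (dvdnn 2))).
  by rewrite dvdn2 /= oddM andbF.
pose d := e + e^-1 - (h + h^-1).
have detR : \det (companion (h + h^-1) d) = 1.
  by rewrite det_mx22 mulr0 sub0r mulNr opprK mulVf.
have [R VR] := V_det1 detR.
have central g : commute c g.
  by apply: V_inj; rewrite !VM Vc; apply/esym/scalar_mxC.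
apply: (torus_set_central up (central R) (central _)).
- by apply: V_inj; rewrite V_cX V1 sqrrN expr1n.
- apply: V_inj; rewrite V_cX VX VR (companion_exp h0 d0 h2 (sign2 u)) //.
  by rewrite -exprM -mulnA mulnC exprM w_half.
- apply: V_inj; rewrite V_cX VX VM Vshear VR shear_companion //.
  rewrite /d addrC subrK (companion_exp e0 d0 e2 (sign2 v)) //.
  by rewrite -exprM mulnAC [(q * p)%N]mulnC exprM w_half.
Qed.

Lemma exists_asymmetric_pair :
  exists2 P1 : gl * gl, P1 \in T (shear, shear) &
    forall P, P \in T (shear, shear) ->
      (P ^+ q * P1 ^+ q)%g \notin <[(shear, shear)]>%g.
Proof.
have [P0 P0T P0q] := exists_torus_set_shear.
apply: (torus_set_asymmetric up torus_set_shear P0T P0q).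
- by apply: V_inj; rewrite V_cX V1 sqrrN expr1n.
- apply/negP => /cycleP[j /(congr1 V)]; rewrite V_shearX Vc.
  rewrite [LHS]mx22P !mxE /= => /mx22_inj[/eqP].
  by rewrite mulr1n (negPf opp1_neq1).
- apply/eqP => /(congr1 V); rewrite V_shearX V1.
  rewrite [RHS]mx22P !mxE => /mx22_inj[_ /eqP + _ _].
  by rewrite (negPf (natF0 _)) // N_gt muln_gt0 pq_gt0.
Qed.

End LinearWitness.

(** * Choice of the finite group *)

Lemma exists_granny_lt_square (p q u v n : nat) :
    (1 < p)%N -> (1 < q)%N -> (1 < n)%N -> (u * p = (q * v).+1)%N ->
  exists gT : finGroupType,
    (#|granny_triples p q u v gT n| < #|square_triples p q u v gT n|)%N.
Proof.
move=> p_gt1 q_gt1 n_gt1 up.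
have pq_gt0 : (0 < p * q)%N by rewrite muln_gt0 (ltnW p_gt1) (ltnW q_gt1).
(* The size of [N] makes it prime to [2 * (p * q)], so that the roots of unity exist, keeps
   [shear ^+ (2 * (p * q))] nontrivial, and makes the order of the shear prime to [n]. *)
have [N N_gt N_pr] := prime_above (2 * (p * q) * n).
have [N_gt_pq N_gt_n] : (2 * (p * q) < N /\ n < N)%N.
  split; apply: leq_ltn_trans N_gt; first by rewrite leq_pmulr // ltnW.
  by rewrite leq_pmull // muln_gt0.
have co_N k : (0 < k < N)%N -> coprime N k.
  by move=> /andP[k0 kN]; rewrite prime_coprime // gtnNdvd.
have [||F [chF [w w_prim]]] := @exists_prim_root N (2 * (p * q)) N_pr.
- by rewrite co_N // muln_gt0 pq_gt0.
- exact: leq_pmulr.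
pose gl : finGroupType := {'GL_2[F]}; pose V (g : gl) : 'M[F]_2 := val g.
have V_det1 (A : 'M[F]_2) : \det A = 1 -> exists g, V g = A.
  move=> dA; have uA : A \is a GRing.unit by rewrite unitmxE dA unitr1.
  by exists (FinRing.Unit uA).
have [shear Vshear] : exists g, V g = mx22 1 1 0 1.
  by apply: V_det1; rewrite det_mx22 mulr0 subr0 mulr1.
have [c Vc] : exists g, V g = (-1)%:M.
  by apply: V_det1; rewrite det_scalar sqrrN expr1n.
have V_inj : injective V := val_inj.
have V1 : V 1%g = 1 by [].
have VM : {morph V : x y / (x * y)%g >-> x * y} by [].
have [P1 P1T noP] := exists_asymmetric_pair p_gt1 q_gt1 up chF N_gt_pq w_prim
  V_inj V1 VM Vshear Vc V_det1.
(* A generator of Z/n, nontrivial because [n > 1]. *)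
pose s : 'I_n.-1.+1 := Zp1.
have os : #[s]%g = n by rewrite order_Zp1 prednK // ltnW.
eexists; apply: (wreath_ltn_granny_square (ltnW n_gt1) _ (s := s) _ _ P1T noP).
- apply: coprime_dvdl (co_N n _); last by rewrite (ltnW n_gt1).
  have := order_shear chF V_inj V1 VM Vshear.
  rewrite !order_dvdn => /eqP e; rewrite pair_expg /= e.
  exact: eqxx.
- by have := expg_order s; rewrite os.
- by rewrite -order_gt1 os.
Qed.

End LinearGroups.

(** * Colourings of torus knot diagrams *)

Section InverseModulo.
Variables (p q u v : nat).
Hypothesis up : (u * p = (q * v).+1)%N.

Lemma inverse_mul k : (u * p * k = k + v * k * q)%N.
Proof. by rewrite up mulSn -mulnA [(q * _)%N]mulnC. Qed.

Lemma inverse_modK k : p * ((u * k) %% q) = k %[mod q].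
Proof. by rewrite modnMmr mulnA [(p * u)%N]mulnC inverse_mul addnC modnMDl. Qed.

Lemma inverse_mulK t : u * (p * t) = t %[mod q].
Proof. by rewrite mulnA inverse_mul addnC modnMDl. Qed.

End InverseModulo.

Section OverArcs.
Variables (p q u v : nat) (gT : finGroupType).
Hypothesis up : (u * p = (q * v).+1)%N.
Implicit Types (m P : gT).
Local Notation T := (torus_set p q u v).

(* The colour of the over-arc at level [k], for the colouring given by [P]. *)
Definition over_arc m P (k : nat) : gT := m ^ (P ^+ (u * k)).

(** The product telescopes: neighbouring conjugators leave [P ^- u] between copies of [m]. *)
Lemma prod_over_arc m P k l :
  \prod_(i < l) over_arc m P (k + i)
  = P ^- (u * k) * (m * P ^- u) ^+ l * P ^+ (u * (k + l)).
Proof.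
elim: l => [|l IHl]; first by rewrite big_ord0 addn0 mulg1 mulVg.
rewrite big_ord_recr IHl /over_arc conjgE /= expgSr addnS mulnS expgnDr.
by rewrite !mulgA mulgK mulgKV.
Qed.

(* An over-arc becomes an over-arc again after passing under the next [p - 1]
   ones.  These relations say that the product of [p] consecutive over-arcs does
   not change from one level to the next, at all but one place of the cycle of
   levels, hence everywhere. *)
Lemma over_arc_complete (c : nat -> gT) :
    0 < p -> 0 < q -> (forall k, c (k + q)%N = c k) ->
    (forall t, t.+1 < q ->
       c (p * t.+1)%N = c (p * t)%N ^ \prod_(i < p.-1) c (p * t + i.+1)%N) ->
  exists2 P, P \in T (c 0%N) & forall k, c k = over_arc (c 0%N) P k.
Proof.
move=> p_gt0 q_gt0 cq rel; pose PP k := \prod_(i < p) c (k + i)%N.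
have cqM k l : c (k + l * q)%N = c k.
  by elim: l => [|l IHl]; rewrite ?addn0 // mulSn [(q + _)%N]addnC addnA cq.
have PPqM k l : PP (k + l * q)%N = PP k.
  by apply: eq_bigr => i _; rewrite addnAC cqM.
have PPE k : PP k = c k * \prod_(i < p.-1) c (k + i.+1)%N.
  by rewrite /PP; case: (p) p_gt0 => // p' _; rewrite big_ord_recl addn0.
have PPS k : PP k.+1 = \prod_(i < p.-1) c (k + i.+1)%N * c (k + p)%N.
  rewrite /PP; case: (p) p_gt0 => // p' _; rewrite big_ord_recr /= addSnnS.
  by congr (_ * _); apply: eq_bigr => i _; rewrite addSnnS.
have PP_step t : t.+1 < q -> PP (p * t).+1%N = PP (p * t)%N.
  move=> t_lt; rewrite [RHS]PPE PPS -mulnSr rel // conjgE.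
  by rewrite mulgA mulgV mul1g.
have PP_step' k : ((u * k) %% q)%N != q.-1 -> PP k.+1 = PP k.
  set t := (_ %% q)%N => t_neq.
  have t_lt : t.+1 < q.
    by rewrite -ltn_predRL ltn_neqAle t_neq -ltnS prednK // ltn_pmod.
  have e : (p * t + p * ((u * k) %/ q) * q = k + v * k * q)%N.
    by rewrite -mulnA -mulnDr addnC -divn_eq mulnA [(p * u)%N]mulnC (inverse_mul up).
  by rewrite -(PPqM k (v * k)%N) -(PPqM k.+1 (v * k)%N) addSn -e -addSn
    !PPqM PP_step.
have co_qu : coprime q u.
  have u_gt0 : 0 < u by case: (u) up.
  by rewrite coprime_sym; apply/(coprimeP _ u_gt0); exists (p, v); rewrite /=
    mulnC up mulnC subSnn.
(* Only levels congruent to [p * q.-1] modulo [q] are exceptional; starting just after one of them,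
   a full period is covered without crossing another. *)
have PP1 j : PP (p * q.-1 + j.+1)%N = PP (p * q.-1).+1%N.
  have PP1' i : i < q -> PP (p * q.-1 + i.+1)%N = PP (p * q.-1).+1%N.
    elim: i => [|i IHi] i_lt; first by rewrite addn1.
    rewrite addnS PP_step' ?IHi ?(ltnW i_lt) // mulnDr mulnA (inverse_mul up).
    rewrite -addnA addnCA modnMDl -{2}(modn_small (m := q.-1) (d := q)) ?prednK //.
    rewrite -[X in _ != X %[mod _]]addn0 eqn_modDl mod0n -/(dvdn q _).
    by rewrite Gauss_dvdr // gtnNdvd.
  rewrite (divn_eq j q) -addnS addnCA addnC PPqM PP1' //.
  exact: ltn_pmod.
have PPc k : PP k = PP 0%N.
  have all_k l : PP l = PP (p * q.-1).+1%N.
    rewrite -(PPqM l (p * q.-1).+1%N).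
    rewrite -[(l + _)%N](subnKC (m := (p * q.-1).+1%N)).
      by rewrite addSnnS PP1.
    by rewrite (leq_trans _ (leq_addl _ _)) // leq_pmulr.
  by rewrite !all_k.
set P := PP 0%N in PPc; set m := c 0%N.
(* Equating the two expansions of the constant [P] gives the relation at every level, including the
   omitted one. *)
have cP k : c (k + p)%N = c k ^ P.
  have e1 := PPE k; have e2 := PPS k; rewrite !PPc -/P in e1 e2.
  have X_P : \prod_(i < p.-1) c (k + i.+1)%N = (c k)^-1 * P.
    by rewrite e1 mulKg.
  apply: (mulgI ((c k)^-1 * P)); rewrite -X_P -e2 X_P conjgE.
  by rewrite !mulgA mulgK mulVg mul1g.
have cpt t : c (p * t)%N = m ^ (P ^+ t).
  elim: t => [|t IHt]; first by rewrite muln0 expg0 conjg1.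
  by rewrite mulnS addnC cP IHt expgSr conjgM.
(* As [u] inverts [p] modulo [q], level [k] is reached by [u * k] shifts by [p]. *)
have cE k : c k = over_arc m P k.
  by rewrite -(cqM k (v * k)%N) -(inverse_mul up) mulnAC mulnC cpt.
exists P => //; apply/torus_setP; split.
  apply/commute_sym/commgP/conjg_fixP; rewrite -cpt.
  by rewrite -[(p * q)%N]add0n cqM.
have := prod_over_arc m P 0 p; rewrite muln0 invg1 mul1g add0n up expgSr.
under eq_bigr do rewrite -cE; rewrite -[LHS]/P.
by rewrite mulgA -{1}[P]mul1g => /mulIg.
Qed.

Section OverArcTheory.
Variables m P : gT.
Hypothesis PT : P \in T m.

Lemma prod_over_arc_period : \prod_(i < p) over_arc m P i = P.
Proof.
have /torus_setP[_ e] := PT; have := prod_over_arc m P 0 p.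
by rewrite muln0 invg1 mul1g add0n up expgSr mulgA e mul1g.
Qed.

Lemma over_arc0 : over_arc m P 0 = m.
Proof. by rewrite /over_arc muln0 conjg1. Qed.

Let conj_mulq k l : m ^ (P ^+ (k + l * q)) = m ^ (P ^+ k).
Proof.
have /torus_setP[cPq _] := PT.
rewrite addnC expgnDr [(_ * q)%N]mulnC expgM conjgM; congr (_ ^ _).
apply/conjg_fixP/commgP; exact/commuteX/commute_sym.
Qed.

Lemma over_arc_mulq k l : over_arc m P (k + l * q) = over_arc m P k.
Proof. by rewrite /over_arc mulnDr mulnA conj_mulq. Qed.

Lemma over_arc_mod k : over_arc m P (k %% q) = over_arc m P k.
Proof. by rewrite [in RHS](divn_eq k q) addnC over_arc_mulq. Qed.

Lemma over_arc_modu k : over_arc m P k = m ^ (P ^+ ((u * k) %% q)).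
Proof. by rewrite /over_arc [in LHS](divn_eq (u * k) q) addnC conj_mulq. Qed.

Lemma over_arc_mulp k t :
  over_arc m P (k + p * t) = over_arc m P k ^ (P ^+ t).
Proof.
by rewrite /over_arc mulnDr mulnA (inverse_mul up) addnA conj_mulq expgnDr conjgM.
Qed.

Lemma prod_next_over_arcs k :
  0 < p -> \prod_(i < p.-1) over_arc m P (k + i.+1) = (over_arc m P k)^-1 * P.
Proof.
move=> p_gt0; apply: (mulgI (over_arc m P k)); rewrite mulKVg.
have := prod_over_arc m P k p; rewrite mulnDr [(u * k + _)%N]addnC expgnDr.
have := prod_over_arc m P 0 p; rewrite muln0 invg1 mul1g add0n.
rewrite prod_over_arc_period => eP; rewrite -[_ * _ * (_ * _)]mulgA.
rewrite [X in _ * X]mulgA -eP.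
rewrite -expgS expgSr mulKg => e; rewrite -[RHS]e {e eP}.
by case: (p) p_gt0 => // p' _; rewrite big_ord_recl addn0.
Qed.

End OverArcTheory.
End OverArcs.

(** * Gauss codes of torus knots *)

Lemma find_flatten (I : Type) (a : pred I) (f : nat -> seq I) j m :
    j < m -> (forall i, i < j -> ~~ has a (f i)) -> has a (f j) ->
  find a (flatten [seq f i | i <- iota 0 m])
  = (size (flatten [seq f i | i <- iota 0 j]) + find a (f j))%N.
Proof.
move=> j_m no_j yes_j.
have -> : m = (j + (m - j.+1).+1)%N by rewrite addnS -addSn subnKC.
rewrite iotaD map_cat flatten_cat find_cat /= find_cat yes_j ifN //.
elim: j no_j {j_m yes_j} => // j IHj no_j; rewrite -addn1 iotaD map_cat.
rewrite flatten_cat has_cat negb_or IHj /= ?cats0 ?no_j // => i i_j.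
by rewrite no_j ?ltnS 1?ltnW.
Qed.

Definition over_index (X : eqType) (code : seq (passage X)) (x : X) : nat :=
  find (fun r => over r && (crossing r == x)) code.

Section UnderProduct.
Variable gT : finGroupType.

Definition signed (pos : bool) (g : gT) : gT := if pos then g else g^-1.

Lemma signedK pos : involutive (signed pos).
Proof. by case: pos => // g; apply: invgK. Qed.

Lemma signedJ pos g h : signed pos (g ^ h) = signed pos g ^ h.
Proof. by case: pos; rewrite //= conjVg. Qed.

(** The conjugator collected along [s]; over a whole code it is the value of the blackboard
    parallel. *)
Definition under_prod (X : Type) (f : X -> gT) (s : seq (passage X)) : gT :=
  \prod_(r <- s | ~~ over r) signed (positive r) (f (crossing r)).

(* [e i] is the colour of the edge leading to the [i]-th passage. *)
Definition colouring (X : eqType) (code : seq (passage X)) (e : nat -> gT) :=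
  forall i, i <= size code ->
    e i = e 0%N ^ under_prod (fun x => e (over_index code x)) (take i code).

End UnderProduct.

Lemma eq_under_prod (X : Type) (gT : finGroupType) (f g : X -> gT) s :
  all (fun r => f (crossing r) == g (crossing r)) s ->
  under_prod f s = under_prod g s.
Proof.
elim: s => [|r s IHs] /=; first by rewrite /under_prod !big_nil.
by case/andP=> /eqP e /IHs; rewrite /under_prod !big_cons e => ->.
Qed.

Lemma eq_colouring (X : eqType) (gT : finGroupType)
    (code : seq (passage X)) (e1 e2 : nat -> gT) :
    (forall i, i <= size code -> e1 i = e2 i) ->
  colouring code e1 -> colouring code e2.
Proof.
move=> e12 col i i_le; rewrite -!e12 // col //; congr (_ ^ _).
by apply: eq_bigr => r _; rewrite e12 ?find_size.
Qed.

Section Torus.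
Variables (p q : nat) (pos : bool).
Hypotheses (p_gt0 : 0 < p) (q_gt0 : 0 < q).

Definition level (j : nat) : seq (passage (nat * nat)) :=
  if (p %| j)%N then [seq Passage (j %% q, i)%N true pos | i <- iota 1 p.-1]
  else [:: Passage (j %% q, p - j %% p)%N false pos].

Definition levels (j : nat) : seq (passage (nat * nat)) :=
  flatten [seq level i | i <- iota 0 j].

Lemma torus_codeE : torus_code p q pos = levels (p * q).
Proof. by []. Qed.

Lemma levelsD j l :
  levels (j + l) = levels j ++ flatten [seq level i | i <- iota j l].
Proof. by rewrite /levels iotaD map_cat flatten_cat. Qed.

Lemma torus_code_split j : j < p * q ->
  exists s, torus_code p q pos = levels j ++ level j ++ s.
Proof.
move=> j_lt; exists (flatten [seq level i | i <- iota j.+1 (p * q - j.+1)]).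
by rewrite torus_codeE -{1}(subnKC j_lt) addSnnS levelsD.
Qed.

Definition torus_crossing (x : nat * nat) : bool := (x.1 < q) && (0 < x.2 < p).

Lemma torus_code_crossings :
  all (fun r => torus_crossing (crossing r)) (torus_code p q pos).
Proof.
rewrite /torus_code; elim: (iota 0 _) => //= j s IHs; rewrite all_cat IHs andbT.
case: ifP => [_|p_j]; rewrite /torus_crossing /=.
  rewrite all_map; apply/allP => i; rewrite mem_iota add1n prednK // => i_p.
  by rewrite /= ltn_pmod.
have j_gt0 : 0 < j %% p by rewrite lt0n; apply: negbT.
by rewrite ltn_pmod // subn_gt0 ltn_pmod // ltn_subrL j_gt0 p_gt0.
Qed.

Variables (gT : finGroupType) (f : nat * nat -> gT).

(** Strand [p * t] only passes over; each of the following [p - 1] strands has exactly one passage,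
    an under-passage. *)
Lemma under_prod_levels t :
  under_prod f (levels (p * t.+1))
  = under_prod f (levels (p * t))
    * \prod_(i < p.-1) signed pos (f ((p * t + i.+1) %% q, p - i.+1)%N).
Proof.
rewrite mulnS addnC levelsD /under_prod big_cat /=; congr (_ * _).
rewrite -[X in iota _ X](prednK p_gt0) /= big_cat /= {1}/level dvdn_mulr //.
rewrite big_map big_pred0 ?mul1g // big_flatten big_map.
rewrite -[(p * t).+1]addn0 iotaDl big_map -[X in iota 0 X]subn0.
rewrite -/(index_iota 0 _) big_mkord; apply: eq_bigr => i _.
rewrite addSnnS /level /dvdn [(p * t)%N]mulnC modnMDl.
have i_p : i.+1 < p by rewrite -ltn_predRL.
by rewrite modn_small //= big_cons big_nil /= mulg1.
Qed.

Variable u v : nat.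
Hypothesis up : (u * p = (q * v).+1)%N.

(** The over-strand at level [k] is strand [p * t] with [t = u * k] modulo [q]; earlier over-strands
    lie at other levels. *)
Lemma over_index_torus k i : k < q -> 0 < i < p ->
  over_index (torus_code p q pos) (k, i)
  = (size (levels (p * ((u * k) %% q))) + i.-1)%N.
Proof.
move=> k_q /andP[i_gt0 i_p]; rewrite /over_index.
set a := fun r => _; set t := ((u * k) %% q)%N.
have t_q : t < q by rewrite ltn_pmod.
have pt_k : (p * t)%N = k %[mod q] by apply: inverse_modK up _.
have i_lt : i.-1 < p.-1 by rewrite -ltnS !prednK.
have i_sz : i.-1 < size (iota 1 p.-1) by rewrite size_iota.
have find_i : find a (level (p * t)) = i.-1.
  rewrite /level dvdn_mulr // find_map.
  rewrite -[RHS](index_uniq 0%N i_sz (iota_uniq _ _)).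
  rewrite nth_iota // add1n prednK //; apply: eq_find => x.
  by rewrite /a /= xpair_eqE pt_k modn_small ?eqxx.
rewrite torus_codeE (find_flatten (j := (p * t)%N)).
- by rewrite find_i.
- by rewrite ltn_mul2l p_gt0.
- move=> j j_lt; rewrite /level; case: ifP => [/dvdnP[t' e]|_ //].
  rewrite has_map; apply/hasPn => x _; rewrite /a /= xpair_eqE.
  apply: contraL j_lt => /andP[/eqP jk _].
  rewrite -leqNgt e [(t' * p)%N]mulnC leq_mul2l.
  have -> : t = t' %% q :> nat.
    by rewrite -(inverse_mulK up) [(p * _)%N]mulnC -e -modnMmr jk.
  by rewrite leq_mod orbT.
- by rewrite has_find find_i /level dvdn_mulr // size_map.
Qed.

Lemma over_index_lt x :
    torus_crossing x ->
  over_index (torus_code p q pos) x < size (torus_code p q pos).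
Proof.
case: x => k i /andP[k_q i_p]; rewrite over_index_torus //.
have t_q : (u * k) %% q < q by rewrite ltn_pmod.
have [|s ->] := @torus_code_split (p * ((u * k) %% q)).
  by rewrite ltn_mul2l p_gt0.
rewrite !size_cat ltn_add2l ltn_addr // /level dvdn_mulr // size_map size_iota.
by case/andP: i_p => i_gt0 i_p; rewrite -ltnS !prednK.
Qed.

Lemma take_torus_code k i : k < q -> 0 < i < p ->
  under_prod f (take (over_index (torus_code p q pos) (k, i))
                  (torus_code p q pos))
  = under_prod f (levels (p * ((u * k) %% q))).
Proof.
move=> k_q i_p; rewrite over_index_torus //; set t := ((u * k) %% q)%N.
have t_q : t < q by rewrite ltn_pmod.
have [|s ->] := @torus_code_split (p * t); first by rewrite ltn_mul2l p_gt0.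
rewrite take_cat ltnNge leq_addr /= addKn /under_prod big_cat /=.
case/andP: i_p => i_gt0 i_p.
rewrite /level dvdn_mulr // takel_cat; last first.
  by rewrite size_map size_iota -ltnS !prednK // ltnW.
by rewrite -map_take big_map [X in _ * X]big_pred0 ?mulg1.
Qed.

End Torus.

(** * Colourings of torus knot codes *)

Section TorusColourings.
Variables (p q u v : nat) (pos : bool) (gT : finGroupType).
Hypotheses (p_gt0 : 0 < p) (q_gt0 : 0 < q).
Hypothesis up : (u * p = (q * v).+1)%N.
Local Notation code := (torus_code p q pos).
Local Notation T := (torus_set p q u v).

(** Inverting all colours exchanges the relations of positive and negative crossings, so one
    [torus_set] serves both mirror images. *)
Definition torus_colour (m P : gT) (x : nat * nat) : gT :=
  signed pos (over_arc u (signed pos m) P x.1).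

Definition torus_colouring (m P : gT) (i : nat) : gT :=
  m ^ under_prod (torus_colour m P) (take i code).

Let eq_under_torus f g i :
    (forall x, torus_crossing p q x -> f x = g x) ->
  under_prod f (take i code) = under_prod g (take i code) :> gT.
Proof.
move=> fg; have := torus_code_crossings pos p_gt0 q_gt0.
rewrite -{1}(cat_take_drop i code) all_cat => /andP[s_ok _].
by apply: eq_under_prod; apply: sub_all s_ok => r /fg ->.
Qed.

(** A colouring supplies the relations between successive over-strands up to the last;
    [over_arc_complete] then yields [P], and with it the closing relation. *)
Lemma colouring_torus (e : nat -> gT) : colouring code e ->
  exists2 P, P \in T (signed pos (e 0%N)) &
    forall i, i <= size code -> e i = torus_colouring (e 0%N) P i.
Proof.
move=> col; pose f x := e (over_index code x).
pose c k :=
  signed pos (e 0%N ^ under_prod f (levels p q pos (p * ((u * k) %% q)))).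
have fc x : torus_crossing p q x -> f x = signed pos (c x.1).
  case: x => k i /andP[k_q i_p]; rewrite /f col ?find_size // /c signedK.
  by rewrite (take_torus_code pos p_gt0 q_gt0 f up).
have c_mod k : c (k %% q) = c k by rewrite /c modnMmr.
have c0 : c 0%N = signed pos (e 0%N).
  by rewrite /c muln0 mod0n muln0 /under_prod big_nil conjg1.
have [|t t_q|P PT cP] := over_arc_complete up (c := c) p_gt0 q_gt0.
- by move=> k; rewrite -c_mod modnDr c_mod.
- rewrite {1 2}/c !(inverse_mulK up) !modn_small //; last exact: ltnW.
  rewrite (under_prod_levels q pos p_gt0) conjgM !signedJ; congr (_ ^ _).
  apply: eq_bigr => i _; rewrite fc ?signedK ?c_mod // /torus_crossing /=.
  have i_p : i.+1 < p by rewrite -ltn_predRL.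
  by rewrite ltn_pmod // subn_gt0 i_p ltn_subrL.
exists P; first by rewrite -c0.
move=> i i_le; rewrite /torus_colouring col //; congr (_ ^ _).
by apply: eq_under_torus => x xT; rewrite [LHS]fc // cP c0.
Qed.

Section Converse.
Variables m P : gT.
Hypothesis PT : P \in T (signed pos m).

(** Each step contributes the inverse of an over-arc times [P], and the product telescopes. At
    [t = q] it relates the blackboard parallel to the central value [P ^+ q]. *)
Lemma under_prod_torus_levels t :
  under_prod (torus_colour m P) (levels p q pos (p * t))
  = signed pos m ^- t * P ^+ t.
Proof.
elim: t => [|t IHt]; first by rewrite muln0 /under_prod big_nil invg1 mulg1.
rewrite (under_prod_levels q pos p_gt0) IHt.
under eq_bigr => i _ do rewrite /torus_colour signedK /= (over_arc_mod PT).
rewrite (prod_next_over_arcs up PT) // -[(p * t)%N]add0n (over_arc_mulp up PT).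
rewrite over_arc0 conjgE !invMg invgK !mulgA mulgK -mulgA -expgSr.
congr (_ * _); rewrite expgSr invMg.
by apply/commuteV/commute_sym/commuteV/commuteX.
Qed.

Lemma torus_colouring_over x : torus_crossing p q x ->
  torus_colouring m P (over_index code x) = torus_colour m P x.
Proof.
case: x => k i /andP[k_q i_p]; rewrite /torus_colouring.
rewrite (take_torus_code pos p_gt0 q_gt0 _ up) // under_prod_torus_levels.
rewrite /torus_colour /= (over_arc_modu PT) signedJ signedK.
rewrite conjgM; congr (_ ^ _).
apply/conjg_fixP/commgP/commuteV/commuteX.
by case: (pos) => /=; [exact: commute_refl | exact/commuteV/commute_refl].
Qed.

Lemma torus_colouring0 : torus_colouring m P 0 = m.
Proof. by rewrite /torus_colouring take0 /under_prod big_nil conjg1. Qed.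

Lemma torus_colouringP : colouring code (torus_colouring m P).
Proof.
move=> i _; rewrite torus_colouring0 {1}/torus_colouring; congr (_ ^ _).
apply: eq_under_torus => x xT; exact/esym/torus_colouring_over.
Qed.

Lemma under_prod_torus_code :
  under_prod (torus_colour m P) code = signed pos m ^- q * P ^+ q.
Proof. exact: under_prod_torus_levels. Qed.

Lemma torus_colouring_size : torus_colouring m P (size code) = m.
Proof.
rewrite /torus_colouring take_size under_prod_torus_code.
have /torus_setP[cP _] := PT.
apply: (can_inj (signedK pos)); rewrite signedJ.
apply/conjg_fixP/commgP/commuteM; first exact/commuteV/commuteX.
exact: commute_sym.
Qed.

Lemma under_prod_torus_colouring (e : nat -> gT) :
    (forall i, i <= size code -> e i = torus_colouring m P i) ->
  under_prod (fun x => e (over_index code x)) code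
  = signed pos m ^- q * P ^+ q.
Proof.
move=> eE; rewrite -under_prod_torus_code -[X in under_prod _ X]take_size.
rewrite -[X in _ = under_prod _ X]take_size.
by apply: eq_under_torus => x xT; rewrite eE ?find_size ?torus_colouring_over.
Qed.

End Converse.

(** [P] is a product of over-arc colours, which can be read off at the crossings [(k, 1)]; these
    exist since [p > 1]. *)
Lemma torus_colouring_inj m P Q : 1 < p ->
    P \in T (signed pos m) -> Q \in T (signed pos m) ->
    (forall i, i <= size code -> torus_colouring m P i = torus_colouring m Q i) ->
  P = Q.
Proof.
move=> p_gt1 PT QT PQ.
rewrite -(prod_over_arc_period up PT) -(prod_over_arc_period up QT).
apply: eq_bigr => k _; rewrite -(over_arc_mod PT) -(over_arc_mod QT).
have xT : torus_crossing p q (k %% q, 1)%N.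
  by rewrite /torus_crossing /= ltn_pmod.
have := PQ (over_index code (k %% q, 1)%N) (find_size _ _).
by rewrite !torus_colouring_over // => /(can_inj (signedK pos)).
Qed.

End TorusColourings.

(** * Generalised knot groups of connect sums *)

Lemma all_steps (X : Type) (gT : finGroupType) (e : nat -> gT)
    (h : passage X -> gT) k s :
  all (fun ir => e ir.1.+1 == if over ir.2 then e ir.1 else e ir.1 ^ h ir.2)
      (zip (iota k (size s)) s) <->
  (forall i, i <= size s ->
     e (k + i)%N = e k ^ \prod_(r <- take i s | ~~ over r) h r).
Proof.
elim: s k => [|r s IHs] k /=.
  by split=> // _ [|i] // _; rewrite addn0 big_nil conjg1.
have stepE : (e k.+1 == if over r then e k else e k ^ h r) <->
    e k.+1 = e k ^ (if ~~ over r then h r else 1).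
  by case: (over r); rewrite /= ?conjg1; split=> [/eqP|->].
split=> [/andP[/stepE ek /IHs es] [|i] i_le|es].
- by rewrite addn0 take0 big_nil conjg1.
- rewrite addnS -addSn es //= big_cons ek -conjgM.
  by case: (over r); rewrite ?mul1g.
apply/andP; split.
  apply/stepE; rewrite -addn1 es //= take0 big_cons big_nil.
  by case: (over r); rewrite ?mulg1.
have ek := es 1%N isT; rewrite addn1 /= take0 big_cons big_nil mulg1 in ek.
apply/IHs => i i_le; rewrite addSnnS es //= big_cons ek -conjgM.
by case: (over r); rewrite ?mul1g.
Qed.

Section Wirtinger.
Variables (K : knot_diagram) (gT : finGroupType).
Local Notation code := (gauss_code K).

Lemma satisfies_wirtinger (g : edge K -> gT) (e := fun i => g (inord i)) :
  satisfies (P := wirtinger K) g <->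
  e (size code) = e 0%N /\ colouring code e.
Proof.
rewrite /satisfies /= !eval_gen all_map.
have -> : ord_max = inord (size code) :> edge K.
  by apply: ord_inj; rewrite inordK.
have -> : ord0 = inord 0 :> edge K by apply: ord_inj; rewrite inordK.
pose h (r : passage (crossings K)) :=
  signed (positive r) (e (over_index code (crossing r))).
rewrite (eq_all (a2 := fun ir => e ir.1.+1 ==
    if over ir.2 then e ir.1 else e ir.1 ^ h ir.2)); last first.
  case=> i r /=; rewrite /wirtinger_relation; case: (over r) => /=.
    by rewrite !eval_gen.
  rewrite eval_gen !eval_cons eval_nil mulg1 /= conjgE /h.
  by case: (positive r); rewrite /= ?invgK.
have := all_steps e h 0 code.
split=> [/andP[/eqP eL /H es]|[eL es]]; first by [].
by apply/andP; split; [apply/eqP|apply/H].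
Qed.

Variable n : nat.
Local Notation G := (generalised_knot_presentation n K).

Lemma satisfies_generalised (phi : option (edge K) -> gT)
    (nu := phi None) (e := fun i => phi (Some (inord i))) :
  satisfies (P := G) phi <->
  [/\ e (size code) = e 0%N, colouring code e, nu ^+ n = e 0%N
    & commute nu (under_prod (fun x => e (over_index code x)) code)].
Proof.
have e0 : e 0%N = phi (Some ord0).
  by congr (phi (Some _)); apply: ord_inj; rewrite inordK.
have nuX : eval phi (flatten (nseq n (gen None))) = nu ^+ n.
  elim: n => [|i IHi]; first by rewrite eval_nil.
  by rewrite /= eval_cons IHi expgS.
have longE : nu ^+ n = e 0%N ->
    commute nu (eval phi (map_word Some (longitude K))) <->
    commute nu (under_prod (fun x => e (over_index code x)) code).
  move=> nu_e; rewrite eval_map eval_cat.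
  set A := eval _ _; set B := eval _ _.
  have -> : under_prod (fun x => e (over_index code x)) code = A.
    rewrite /A eval_flatten big_map big_filter; apply: eq_bigr => r _.
    by rewrite /under_word eval_cons eval_nil mulg1.
  (* The writhe correction is a product of powers of the meridian [nu ^+ n], so it drops out of the
     commutation condition. *)
  have cB : B \in 'C[nu].
    rewrite /B /eval big_map big_filter; apply: group_prod => r _ /=.
    by rewrite -e0 -nu_e fun_if; case: (~~ _); rewrite ?groupV groupX ?cent1id.
  have cE x : commute nu x <-> x \in 'C[nu].
    by split=> [/commute_sym/cent1P|/cent1P/commute_sym].
  by rewrite !cE groupMr.
have := satisfies_wirtinger (fun x => phi (Some x)); rewrite -/e => W.
set A := eval phi (map_word Some (longitude K)) in longE.
have -> : satisfies (P := G) phi =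
    [&& satisfies (P := wirtinger K) (fun x => phi (Some x)),
        nu ^+ n == e 0%N & nu * A == A * nu].
  rewrite /satisfies; have -> : relations G =
      [seq (map_word Some r.1, map_word Some r.2) | r <- relations (wirtinger K)]
      ++ [:: (flatten (nseq n (gen None)), map_word Some (meridian K));
             (gen None ++ map_word Some (longitude K),
              map_word Some (longitude K) ++ gen None)] by [].
  rewrite all_cat all_map; congr (_ && _).
    by apply: eq_all => r; rewrite [preim _ _ _]/= !eval_map.
  rewrite [LHS]/= andbT nuX e0 !eval_cons !eval_nil mulg1.
  by rewrite eval_cat eval_gen.
split=> [/and3P[/W[eL ce] /eqP nu_e /eqP /longE]|[eL ce nu_e]].
  by move=> /(_ nu_e).
by move/longE => /(_ nu_e) /eqP ->; rewrite nu_e eqxx !andbT; apply/W.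
Qed.

End Wirtinger.

Lemma under_prod_cat (X : Type) (gT : finGroupType) (f : X -> gT) s1 s2 :
  under_prod f (s1 ++ s2) = under_prod f s1 * under_prod f s2.
Proof. exact: big_cat. Qed.

(** This excludes the default value of [over_index], the length of the code, which changes in a
    connect sum. *)
Definition well_coded (X : eqType) (code : seq (passage X)) : bool :=
  all (fun r => has (fun r' => over r' && (crossing r' == crossing r)) code)
    code.

(** * Colourings of connect sums *)

Section ConnectSum.
Variables (K1 K2 : knot_diagram) (gT : finGroupType).
Local Notation code1 := (gauss_code K1).
Local Notation code2 := (gauss_code K2).
Local Notation code := (gauss_code (connect_sum K1 K2)).
Hypothesis wf1 : well_coded code1.
Variable e : nat -> gT.
Let e2 i := e (size code1 + i).

Lemma size_connect_sum : size code = (size code1 + size code2)%N.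
Proof. by rewrite size_cat !size_map. Qed.

Let code1_over r :
  has (fun r' => over r' && (crossing r' == crossing r)) code1 ->
  over_index code (inl (crossing r)) = over_index code1 (crossing r).
Proof.
by move=> has_r; rewrite /over_index find_cat has_map has_r find_map.
Qed.

Let code2_over y :
  over_index code (inr y) = (size code1 + over_index code2 y)%N.
Proof.
rewrite /over_index find_cat has_map size_map.
rewrite (eq_has (a2 := pred0)) ?has_pred0 ?find_map // => r /=.
by rewrite andbF.
Qed.

Let under1 i :
  under_prod (fun x => e (over_index code x))
    (take i [seq Passage (inl (crossing r) : crossings (connect_sum K1 K2))
               (over r) (positive r) | r <- code1])
  = under_prod (fun x => e (over_index code1 x)) (take i code1).
Proof.
rewrite -map_take {1}/under_prod big_map.
transitivity (under_prod (fun x => e (over_index code (inl x))) (take i code1)).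
  by [].
apply: eq_under_prod.
have := wf1; rewrite /well_coded -{2}(cat_take_drop i code1) all_cat.
by case/andP => + _; apply: sub_all => r /code1_over ->.
Qed.

Let under2 i :
  under_prod (fun x => e (over_index code x))
    (take i [seq Passage (inr (crossing r) : crossings (connect_sum K1 K2))
               (over r) (positive r) | r <- code2])
  = under_prod (fun x => e2 (over_index code2 x)) (take i code2).
Proof.
rewrite -map_take /under_prod big_map; apply: eq_bigr => r _.
by rewrite code2_over.
Qed.

Let under1_full := under1 (size code1).
Let under2_full := under2 (size code2).

Lemma under_prod_connect_sum :
  under_prod (fun x => e (over_index code x)) code
  = under_prod (fun x => e (over_index code1 x)) code1
    * under_prod (fun x => e2 (over_index code2 x)) code2.
Proof.
have := under1_full; have := under2_full.
rewrite !take_size !take_oversize ?size_map // => <- <-.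
by rewrite -under_prod_cat.
Qed.

Lemma colouring_connect_sum :
  colouring code e <-> colouring code1 e /\ colouring code2 e2.
Proof.
have e20 : e2 0 = e (size code1) by rewrite /e2 addn0.
have u1 := under1_full; rewrite take_size take_oversize ?size_map // in u1.
split=> [col|[col1 col2] i i_le].
  have col1 : colouring code1 e.
    move=> i i_le; rewrite col ?size_connect_sum ?(leq_trans i_le) ?leq_addr //.
    by rewrite -under1 takel_cat // size_map.
  split=> // i i_le; rewrite /e2 col ?size_connect_sum ?leq_add2l //.
  rewrite take_cat size_map ltnNge leq_addr addKn addn0 (col1 _ (leqnn _)).
  by rewrite /= under_prod_cat u1 under2 conjgM take_size.
case: (leqP i (size code1)) => [i_le1|i_gt].
  by rewrite col1 // -under1 takel_cat // size_map.
have [k [k_le ->]] : exists k, k <= size code2 /\ i = (size code1 + k)%N.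
  exists (i - size code1)%N; rewrite subnKC ?(ltnW i_gt) //.
  by rewrite leq_subLR -size_connect_sum.
rewrite -/(e2 k) col2 // e20 col1 // -conjgM; congr (_ ^ _).
rewrite take_cat size_map ltnNge leq_addr addKn /= under_prod_cat u1 under2.
by rewrite take_size.
Qed.

End ConnectSum.

(** * Homomorphisms for sums of two torus knots *)

Section TorusSums.
Variables (p q u v : nat) (pos : bool) (gT : finGroupType) (n : nat).
Hypotheses (p_gt1 : 1 < p) (q_gt0 : 0 < q).
Hypothesis up : (u * p = (q * v).+1)%N.

Definition torus_diagram (e : bool) : knot_diagram :=
  @KnotDiagram (nat * nat)%type (torus_code p q e).

Local Notation K := (connect_sum (torus_diagram true) (torus_diagram pos)).
Local Notation G := (generalised_knot_presentation n K).
Local Notation T := (torus_set p q u v).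
Local Notation L1 := (size (torus_code p q true)).
Local Notation L2 := (size (torus_code p q pos)).

(** The two values of [pos] give [granny_triples] and [square_triples] by unfolding. *)
Definition colouring_triples : {set gT * (gT * gT)} :=
  [set w | [&& w.2.1 \in T (w.1 ^+ n), w.2.2 \in T (signed pos (w.1 ^+ n))
             & w.2.1 ^+ q * w.2.2 ^+ q \in 'C[w.1]]].

Let p_gt0 : 0 < p. Proof. exact: ltnW. Qed.

Lemma well_coded_torus e : well_coded (torus_code p q e).
Proof.
apply: sub_all (torus_code_crossings e p_gt0 q_gt0) => r rT.
by rewrite has_find; apply: (over_index_lt e p_gt0 q_gt0 up).
Qed.

(** Edge [L1] belongs to both summands; for triples in [colouring_triples] both formulas give [m]
    there. *)
Definition triple_colouring (w : gT * (gT * gT)) (i : nat) : gT :=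
  let m := w.1 ^+ n in
  if i <= L1 then torus_colouring p q u true m w.2.1 i
  else torus_colouring p q u pos m w.2.2 (i - L1).

Definition triple_assignment (w : gT * (gT * gT)) :
    {ffun generators G -> gT} :=
  [ffun o => if o is Some i then triple_colouring w (i : 'I_(_).+1) else w.1].

Let size_K : size (gauss_code K) = (L1 + L2)%N.
Proof. exact: size_connect_sum. Qed.

Lemma satisfies_torus_sum (phi : option (edge K) -> gT) :
  satisfies (P := G) phi <->
  exists2 w, w \in colouring_triples &
    w.1 = phi None /\
    forall i, i <= L1 + L2 -> phi (Some (inord i)) = triple_colouring w i.
Proof.
have [e eE] : exists e : nat -> gT, e = fun i => phi (Some (inord i)).
  by exists (fun i => phi (Some (inord i))).
have [nu nuE] : exists nu, nu = phi None by exists (phi None).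
have satE : satisfies (P := G) phi <->
    [/\ e (L1 + L2)%N = e 0%N, colouring (gauss_code K) e, nu ^+ n = e 0%N
      & commute nu (under_prod (fun x => e (over_index (gauss_code K) x))
                     (gauss_code K))].
  by rewrite -size_K eE nuE; apply: satisfies_generalised.
have eI i : phi (Some (inord i)) = e i by rewrite eE.
rewrite satE -nuE.
have wf := well_coded_torus true.
have colE :=
  colouring_connect_sum (K1 := torus_diagram true) (torus_diagram pos) wf e.
have underE :=
  under_prod_connect_sum (K1 := torus_diagram true) (torus_diagram pos) wf e.
(* The powers of [m] can be collected in front, and they commute with [nu]. *)
have centE m P Q : m = nu ^+ n -> P \in T m -> Q \in T (signed pos m) ->
    commute nu (m ^- q * P ^+ q * (signed pos m ^- q * Q ^+ q)) <->
    P ^+ q * Q ^+ q \in 'C[nu].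
  move=> mE /torus_setP[cP _] _.
  have cPm : commute (P ^+ q) (signed pos m ^- q).
    apply/commuteV/commuteX; case: (pos) => //=; exact: commuteV.
  have cm : m ^- q * signed pos m ^- q \in 'C[nu].
    have mC : m \in 'C[nu] by rewrite mE groupX ?cent1id.
    by rewrite groupM ?groupV ?groupX //; case: (pos); rewrite /= ?groupV.
  rewrite mulgA -[m ^- q * _ * _]mulgA cPm mulgA -mulgA -(groupMl _ cm).
  by split=> [/commute_sym/cent1P|/cent1P/commute_sym].
have underPQ m P Q : P \in T m -> Q \in T (signed pos m) ->
    (forall i, i <= L1 -> e i = torus_colouring p q u true m P i) ->
    (forall i, i <= L2 -> e (L1 + i)%N = torus_colouring p q u pos m Q i) ->
    under_prod (fun x => e (over_index (gauss_code K) x)) (gauss_code K)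
    = m ^- q * P ^+ q * (signed pos m ^- q * Q ^+ q).
  move=> PT QT eP eQ; rewrite underE; congr (_ * _).
    exact: (under_prod_torus_colouring (pos := true) p_gt0 q_gt0 up PT).
  exact: (under_prod_torus_colouring (e := fun i => e (L1 + i)%N)
    p_gt0 q_gt0 up QT).
split.
  case=> eL /colE[col1 col2] nu_e cnu.
  have [P PT eP] := colouring_torus p_gt0 q_gt0 up col1.
  have [Q QT eQ] := colouring_torus p_gt0 q_gt0 up col2.
  rewrite /= in PT eP QT eQ.
  (* The first summand closes up by itself, so both summands have the same base meridian. *)
  have e1 : e L1 = e 0%N.
    by rewrite eP // (torus_colouring_size (pos := true) p_gt0 up PT).
  rewrite addn0 e1 in QT eQ.
  exists (nu, (P, Q)); last first.
    split=> // i i_le; rewrite eI /triple_colouring /= nu_e.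
    case: leqP => [/eP //|i_gt]; rewrite -eQ ?leq_subLR //.
    by rewrite subnKC // ltnW.
  rewrite in_set /= nu_e PT QT /=.
  by apply/(centE (e 0%N)) => //; rewrite -(underPQ _ _ _ PT QT eP eQ).
case=> -[nu' [P Q]] + [/= nu'E] eW; rewrite {nu'}nu'E in eW *.
rewrite in_set /= => /and3P[PT QT cPQ]; set m := nu ^+ n in PT QT eW.
have eP i : i <= L1 -> e i = torus_colouring p q u true m P i.
  move=> i_le; rewrite -eI eW ?(leq_trans i_le) ?leq_addr //.
  by rewrite /triple_colouring /= i_le.
have e0 : e 0%N = m by rewrite eP // torus_colouring0.
have eQ i : i <= L2 -> e (L1 + i)%N = torus_colouring p q u pos m Q i.
  case: i => [_|i i_le].
    by rewrite addn0 eP // (torus_colouring_size (pos := true) p_gt0 up PT)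
      torus_colouring0.
  rewrite -eI eW ?leq_add2l // /triple_colouring /= leqNgt -addn1 leq_add2l.
  by rewrite addKn.
split.
- by rewrite eQ // (torus_colouring_size p_gt0 up QT).
- apply/colE; split.
    apply: eq_colouring (torus_colouringP (pos := true) p_gt0 q_gt0 up PT).
    by move=> i /eP ->.
  apply: eq_colouring (torus_colouringP p_gt0 q_gt0 up QT).
  by move=> i /eQ ->.
- by rewrite e0.
by rewrite (underPQ _ _ _ PT QT eP eQ); apply/centE.
Qed.

Lemma triple_assignmentP (phi : {ffun generators G -> gT}) w :
  (w.1 = phi None /\
   forall i, i <= L1 + L2 -> phi (Some (inord i)) = triple_colouring w i) <->
  phi = triple_assignment w.
Proof.
split=> [[w1 phiE]|->]; last first.
  split=> [|i i_le]; first by rewrite ffunE.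
  by rewrite ffunE inordK // size_K ltnS.
apply/ffunP => -[i|]; rewrite ffunE // -phiE ?inord_val //.
by rewrite -ltnS -size_K ltn_ord.
Qed.

Lemma triple_assignment_inj :
  {in colouring_triples &, injective triple_assignment}.
Proof.
move=> [nu [P Q]] [nu' [P' Q']].
rewrite in_set => /and3P[/= PT QT _]; rewrite in_set => /and3P[/= PT' QT' _] e.
have [nuE e1] := (triple_assignmentP _ (nu, (P, Q))).2 erefl.
have [nuE' e2] := (triple_assignmentP _ (nu', (P', Q'))).2 erefl.
have {nuE nuE'} nuE : nu = nu' by rewrite [LHS]nuE e -nuE'.
rewrite -{nu'}nuE in PT' QT' e e2 *.
have e12 i : i <= L1 + L2 ->
    triple_colouring (nu, (P, Q)) i = triple_colouring (nu, (P', Q')) i.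
  by move=> i_le; rewrite -e1 // e e2.
congr (_, (_, _)).
  apply: (torus_colouring_inj (pos := true) p_gt0 q_gt0 up p_gt1 PT PT').
  move=> i i_le; have := e12 i (leq_trans i_le (leq_addr _ _)).
  by rewrite /triple_colouring /= i_le.
apply: (torus_colouring_inj p_gt0 q_gt0 up p_gt1 QT QT') => -[_|i i_le].
  by rewrite !torus_colouring0.
have := e12 (L1 + i.+1)%N; rewrite leq_add2l => /(_ i_le).
by rewrite /triple_colouring /= leqNgt -addn1 leq_add2l addKn.
Qed.

Lemma card_satisfies :
  #|[set phi : {ffun generators G -> gT} | satisfies phi]|
  = #|colouring_triples|.
Proof.
rewrite -(card_in_imset triple_assignment_inj); apply: eq_card => phi.
rewrite in_set; apply/idP/imsetP => [/satisfies_torus_sum[w wS]|[w wS phiE]].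
  by move/triple_assignmentP => phiE; exists w.
apply/satisfies_torus_sum; exists w => //; exact/triple_assignmentP.
Qed.

Lemma card_group_homs_torus_sum :
  (group_homs (generalised_knot_group n K) gT #= `I_#|colouring_triples|)%card.
Proof. by rewrite -card_satisfies; apply: card_group_homs. Qed.

End TorusSums.

(** * Counting homomorphisms for [GK] and [SK] *)

Lemma GK_torus a b :
  GK a b = connect_sum (torus_diagram a b true) (torus_diagram a b true).
Proof. by []. Qed.

Lemma SK_torus a b : 0 < a -> 0 < b ->
  SK a b = connect_sum (torus_diagram a b true) (torus_diagram a b false).
Proof. by case: a b => [|a] [|b]. Qed.

Local Close Scope group_scope.

Theorem theorem1p1 (a b n : nat) (ha : 2 <= a) (hb : 2 <= b) (hn : 2 <= n)
    (hab : coprime a b) :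
  (coprime (a * b) n ->
    exists s t : nat,
      [/\ prime s, prime t, s %| a, t %| b & coprime (s * t) n]) /\
  ((exists s t : nat,
      [/\ prime s, prime t, s %| a, t %| b & coprime (s * t) n]) ->
    exists (H : finGroupType) (k m : nat),
      [/\ (group_homs (generalised_knot_group n (GK a b)) H #= `I_k)%card,
          (group_homs (generalised_knot_group n (SK a b)) H #= `I_m)%card
        & k < m]).
Proof.
have [a_gt0 b_gt0] : 0 < a /\ 0 < b by split; apply: ltnW.
split=> [co_abn|_].
  exists (pdiv a), (pdiv b); rewrite !pdiv_prime ?pdiv_dvd //; split=> //.
  exact: coprime_dvdl (dvdn_mul (pdiv_dvd a) (pdiv_dvd b)) co_abn.
(* Bezout coefficients, taken as natural numbers. *)
have [u [v uv]] : exists u v, u * a = (b * v).+1.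
  case: (egcdnP b a_gt0) => u v + _; rewrite (eqP hab) addn1 mulnC => e.
  by exists u, v; rewrite mulnC e mulnC.
have [H lt_H] := exists_granny_lt_square ha hb hn uv.
exists H, #|granny_triples a b u v H n|, #|square_triples a b u v H n|; split=> //.
  by rewrite GK_torus; apply: card_group_homs_torus_sum.
by rewrite SK_torus //; apply: card_group_homs_torus_sum.
Qed.
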